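(* Let $\mathcal M$ be a differentiable submanifold of $\mathbb{R}^n$, with Riemannian measure $m_{\mathcal M}$, and identify $\mathbb{R}^n$ with $\mathbb{R}^{n\times1}$. (A) $\mathcal M$ is extremal if and only if $\mathcal M$ is simultaneously inhomogeneously extremal. (B) Suppose further that at almost every point of $\mathcal M$ the tangent plane is not orthogonal to any of the coordinate axes. Then $\mathcal M$ is strongly extremal if and only if $\mathcal M$ is simultaneously inhomogeneously strongly extremal.
   Context: Notation: for $\mathbf q\in\mathbb{Z}^n$ (resp. $\mathbb{Z}^1$ here for columns), $|\cdot|$ is the sup norm and $\prod_+(\mathbf q)=\prod_i\max\{1,|q_i|\}$; for $\mathbf y\in\mathbb{R}^m$, $\langle\mathbf y\rangle$ is the unique point in $[-1/2,1/2)^m$ congruent to $\mathbf y$ mod $\mathbb{Z}^m$, $\|\mathbf y\|=|\langle\mathbf y\rangle|$, $\prod\mathbf y=\prod_j|y_j|$. For $X\in\mathbb{R}^{m\times k}$ and $\boldsymbol\theta\in\mathbb{R}^m$: $w(X,\boldsymbol\theta)$ is the supremum of $w\ge0$ such that for arbitrarily large $Q>1$ there is $\mathbf q\in\mathbb{Z}^k\setminus\{\mathbf0\}$ with $\|X\mathbf q+\boldsymbol\theta\|^m<Q^{-w}$ and $|\mathbf q|^k\le Q$; $w^\times(X,\boldsymbol\theta)$ is defined likewise with $\prod\langle X\mathbf q+\boldsymbol\theta\rangle<Q^{-w}$ and $\prod_+(\mathbf q)\le Q$; $w(X)=w(X,\mathbf0)$, $w^\times(X)=w^\times(X,\mathbf0)$.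 $\mathcal M$ is extremal (resp. strongly extremal) if $w(\mathbf x)=1$ (resp. $w^\times(\mathbf x)=1$) for $m_{\mathcal M}$-a.e. $\mathbf x\in\mathcal M$ (with $\mathbf x$ viewed as an element of $\mathbb{R}^{n\times1}$; equivalently of $\mathbb{R}^{1\times n}$). $\mathcal M$ is simultaneously inhomogeneously extremal (resp. strongly extremal) if for every $\boldsymbol\theta\in\mathbb{R}^n$, $w(\mathbf x,\boldsymbol\theta)=1$ (resp. $w^\times(\mathbf x,\boldsymbol\theta)=1$) for $m_{\mathcal M}$-a.e. $\mathbf x\in\mathcal M$, where $\mathbf x\in\mathbb{R}^{n\times1}$.
   Formalization: The submanifold M is assumed to have positive dimension: for a single point M={x} with w(x)=1, part (A) fails with θ=-x, since q=1 then gives w(x,θ)=+∞. *)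

(* Defs.v *)
From HB Require Import structures.
From mathcomp Require Import all_boot all_order all_algebra.
From mathcomp Require Import all_classical all_reals all_analysis.

Set Implicit Arguments.
Unset Strict Implicit.
Unset Printing Implicit Defensive.

Import Order.TTheory GRing.Theory Num.Theory.
Import numFieldNormedType.Exports.

Local Open Scope classical_set_scope.
Local Open Scope ring_scope.

Section exponents.
Context {R : realType}.

(* The representative of y mod 1 in [-1/2, 1/2). *)
Definition centered (y : R) : R := y - (Num.floor (y + 2^-1))%:~R.

Definition centered_mx m (y : 'cV[R]_m) : 'cV[R]_m := map_mx centered y.

(* `|_| on column vectors is the sup norm (mx_norm). *)
Definition dist_int m (y : 'cV[R]_m) : R := `|centered_mx y|.

Definition prod_abs m (y : 'cV[R]_m) : R := \prod_(j < m) `|y j 0|.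

Definition int_cV k (q : 'cV[int]_k) : 'cV[R]_k := map_mx intr q.

Definition prod_plus k (q : 'cV[int]_k) : R :=
  \prod_(i < k) Num.max 1 `|int_cV q i 0|.

Definition approximable m k (X : 'M[R]_(m, k)) (theta : 'cV[R]_m)
    (w Q : R) : Prop :=
  exists q : 'cV[int]_k, [/\ q != 0,
    dist_int (X *m int_cV q + theta) ^+ m < Q `^ (- w) &
    `|int_cV q| ^+ k <= Q].

Definition mult_approximable m k (X : 'M[R]_(m, k)) (theta : 'cV[R]_m)
    (w Q : R) : Prop :=
  exists q : 'cV[int]_k, [/\ q != 0,
    prod_abs (centered_mx (X *m int_cV q + theta)) < Q `^ (- w) &
    prod_plus q <= Q].

Definition arbitrarily_large (P : R -> Prop) : Prop :=
  forall Q0 : R, exists Q, [/\ Q0 < Q, 1 < Q & P Q].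

Definition exponent m k (X : 'M[R]_(m, k)) (theta : 'cV[R]_m) : \bar R :=
  ereal_sup [set w%:E | w in
    [set w | 0 <= w /\ arbitrarily_large (approximable X theta w)]].

Definition mult_exponent m k (X : 'M[R]_(m, k)) (theta : 'cV[R]_m) : \bar R :=
  ereal_sup [set w%:E | w in
    [set w | 0 <= w /\ arbitrarily_large (mult_approximable X theta w)]].

End exponents.

Section lebesgue_tuple.
Context {R : realType}.
Local Open Scope ereal_scope.

Definition cons_pair d (p : measurableTypeR R * d.-tuple (measurableTypeR R)) :
  d.+1.-tuple (measurableTypeR R) := [tuple of p.1 :: p.2].

(* d-dimensional Lebesgue measure, as an iterated product measure. *)
Fixpoint lebesgue_tuple (d : nat) :
    set (d.-tuple (measurableTypeR R)) -> \bar R :=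
  match d with
  | 0 => dirac (nil_tuple (measurableTypeR R))
  | d'.+1 =>
      pushforward (lebesgue_measure \x @lebesgue_tuple d') (@cons_pair d')
  end.

Lemma measurable_cons_pair d : measurable_fun setT (@cons_pair d).
Proof. exact: (measurable_cons measurable_fst measurable_snd). Qed.

Let sigma_finite_facts d (T : measurableType d) (mu : set T -> \bar R) :=
  [/\ mu set0 = 0, (forall A, 0 <= mu A), semi_sigma_additive mu &
      sigma_finite setT mu].

Let pushforward_cons_facts d
    (mu : {sigma_finite_measure set (d.-tuple (measurableTypeR R)) -> \bar R}) :
  sigma_finite_facts (pushforward (lebesgue_measure \x mu) (@cons_pair d)).
Proof.
have mc A : measurable A -> measurable (@cons_pair d @^-1` A).
  by move=> mA; rewrite -[X in measurable X]setTI; exact: measurable_cons_pair.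
split.
- by rewrite /pushforward preimage_set0 measure0.
- by move=> A; rewrite /pushforward; exact: measure_ge0.
- move=> F mF tF mUF; rewrite /pushforward preimage_bigcup.
  apply: measure_semi_sigma_additive.
  + by move=> n; exact: mc.
  + apply/trivIsetP => /= i j _ _ ij; rewrite -preimage_setI.
    by move/trivIsetP : tF => /(_ _ _ _ _ ij) ->//; rewrite preimage_set0.
  + by rewrite -preimage_bigcup; exact: mc.
- have [F [FT Ffin]] : exists F : (set (measurableTypeR R * _))^nat,
      setT = \bigcup_i F i /\
      forall i, measurable (F i) /\ (lebesgue_measure \x mu) (F i) < +oo.
    have /sigma_finiteP[F [TF ndF Foo]] :=
      sigma_finiteT (@lebesgue_measure R).
    have /sigma_finiteP[G [TG ndG Goo]] := sigma_finiteT mu.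
    exists (fun i => F i `*` G i); split.
      rewrite -setXTT TF TG predeqE => -[x y]; split => [[/= [i _ Fx] [j _ Gy]]|].
        exists (maxn i j) => //; split.
        - by move: x Fx; exact/subsetPset/ndF/leq_maxl.
        - by move: y Gy; exact/subsetPset/ndG/leq_maxr.
      by move=> [i _ []/= ? ?]; split; exists i.
    move=> i; have [? ?] := Foo i; have [? ?] := Goo i.
    split; first exact: measurableX.
    by rewrite product_measure1E// lte_mul_pinfty// ge0_fin_numE.
  pose uncons (t : d.+1.-tuple (measurableTypeR R)) :=
    (thead t, [tuple of behead t] : d.-tuple (measurableTypeR R)).
  have consK : cancel (@cons_pair d) uncons.
    by move=> [x t]; rewrite /uncons /cons_pair theadE; congr pair; exact/val_inj.
  have m_uncons A : measurable A -> measurable (uncons @^-1` A).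
    have mf : measurable_fun setT uncons.
      apply: measurable_fun_pair; first exact: measurable_tnth.
      exact: measurable_behead.
    by move=> mA; rewrite -[X in measurable X]setTI; exact: mf.
  exists (fun i => uncons @^-1` F i).
    by rewrite -preimage_bigcup -FT preimage_setT.
  move=> i; have [mF Foo] := Ffin i; split; first exact: m_uncons.
  rewrite /pushforward -comp_preimage.
  suff -> : uncons \o @cons_pair d = id by rewrite preimage_id.
  by apply/funext => p /=; rewrite consK.
Qed.

Let lebesgue_tuple_facts d : sigma_finite_facts (@lebesgue_tuple d).
Proof.
elim: d => [|d [m0 m_ge0 m_sa m_sf]].
  pose delta : {measure set _ -> \bar R} :=
    dirac (nil_tuple (measurableTypeR R)).
  split; first exact: (measure0 delta).
  - by move=> A; exact: (measure_ge0 delta).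
  - exact: (@measure_semi_sigma_additive _ _ _ delta).
  - apply: (@fin_num_fun_sigma_finite _ _ _ delta); first by rewrite measure0.
    exact: fin_num_measure.
pose ms := isMeasure.Build _ _ _ _ m0 m_ge0 m_sa.
pose mm : {measure set _ -> \bar R} := HB.pack (@lebesgue_tuple d) ms.
pose sf := Measure_isSigmaFinite.Build _ _ _ mm m_sf.
pose mu : {sigma_finite_measure set _ -> \bar R} :=
  HB.pack (Measure.sort mm) ms sf.
exact: (pushforward_cons_facts mu).
Qed.

Let lebesgue_tuple0 d : @lebesgue_tuple d set0 = 0 :> \bar R.
Proof. by have [] := lebesgue_tuple_facts d. Qed.

Let lebesgue_tuple_ge0 d (A : set (d.-tuple (measurableTypeR R))) :
  0 <= lebesgue_tuple A.
Proof. by have [] := lebesgue_tuple_facts d. Qed.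

Let lebesgue_tuple_sigma_additive d : semi_sigma_additive (@lebesgue_tuple d).
Proof. by have [] := lebesgue_tuple_facts d. Qed.

HB.instance Definition _ d := isMeasure.Build _ _ _ (@lebesgue_tuple d)
  (@lebesgue_tuple0 d) (@lebesgue_tuple_ge0 d)
  (@lebesgue_tuple_sigma_additive d).

Let lebesgue_tuple_sigma_finite d : sigma_finite setT (@lebesgue_tuple d).
Proof. by have [] := lebesgue_tuple_facts d. Qed.

HB.instance Definition _ d := Measure_isSigmaFinite.Build _ _ _
  (@lebesgue_tuple d) (@lebesgue_tuple_sigma_finite d).

Lemma lebesgue_tupleS d (A : set (measurableTypeR R))
    (B : set (d.-tuple (measurableTypeR R))) :
  measurable A -> measurable B ->
  lebesgue_tuple [set t : d.+1.-tuple (measurableTypeR R) |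
    A (thead t) /\ B [tuple of behead t]] =
  lebesgue_measure A * lebesgue_tuple B.
Proof.
move=> mA mB; rewrite -product_measure1E//= /pushforward; congr product_measure1.
apply/seteqP; split => -[x t] /=; rewrite /cons_pair theadE.
  by move=> [Ax Bt]; split => //; rewrite (_ : t = [tuple of behead [tuple of x :: t]])//; exact/val_inj.
by move=> [/= Ax Bt]; split => //; rewrite (_ : [tuple of _] = t)//; exact/val_inj.
Qed.

End lebesgue_tuple.
Arguments lebesgue_tuple {R} d _.

Definition borel_rV (R : realType) (n : nat) :=
  g_sigma_algebraType (@open 'rV[R]_n).

Section submanifolds.
Context {R : realType} {d n : nat}.
Implicit Types (M : set 'rV[R]_n) (U : set 'rV[R]_d)
  (phi : 'rV[R]_d -> 'rV[R]_n).

Definition C1_on U phi : Prop :=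
  forall u, U u -> differentiable phi u /\ {for u, continuous (fun v => 'J phi v)}.

Definition immersion_on U phi : Prop :=
  C1_on U phi /\ forall u, U u -> injective ('d phi u).

(* The last two conditions say that phi is a homeomorphism of U onto an open
   subset of M for the topology induced by R^n. *)
Definition local_parametrization M U phi : Prop :=
  [/\ open U, immersion_on U phi, {in U &, injective phi} &
      forall W, open W -> W `<=` U ->
        exists2 V : set 'rV[R]_n, open V & phi @` W = M `&` V].

(* Density of the Riemannian volume in the coordinates phi; 'J phi u acts on
   row vectors, so the metric is the d x d Gram matrix below. *)
Definition volume_density phi (u : 'rV[R]_d) : R :=
  Num.sqrt (\det ('J phi u *m ('J phi u)^T)).

Definition row_of_tuple (t : d.-tuple R) : 'rV[R]_d := \row_i tnth t i.

Definition chart_volume U phi (B : set 'rV[R]_n) : \bar R :=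
  \int[lebesgue_tuple d]_(t in [set t | U (row_of_tuple t) /\
      B (phi (row_of_tuple t))]) (volume_density phi (row_of_tuple t))%:E.

(* Finite families of pairwise disjoint Borel pieces of A, each lying in a
   single chart; for A Borel the supremum of their total volumes is the
   Riemannian measure of A. *)
Definition riemannian_measure M (A : set (borel_rV R n)) : \bar R :=
  ereal_sup [set v | exists k (U : 'I_k -> set 'rV[R]_d)
      (phi : 'I_k -> 'rV[R]_d -> 'rV[R]_n) (B : 'I_k -> set (borel_rV R n)),
    [/\ forall i, local_parametrization M (U i) (phi i),
        forall i, measurable (B i) /\ B i `<=` A `&` phi i @` U i,
        trivIset setT B &
        v = (\sum_(i < k) chart_volume (U i) (phi i) (B i))%E]].

Definition tangent_space M (x : 'rV[R]_n) : set 'rV[R]_n :=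
  [set v | exists U phi u, [/\ local_parametrization M U phi, U u,
    phi u = x & exists h, v = 'd phi u h]].

End submanifolds.
Arguments riemannian_measure {R} d {n} M A.
Arguments tangent_space {R} d {n} M x.

Section extremality.
Context {R : realType} (d : nat) {n : nat}.
Implicit Types M : set 'rV[R]_n.

(* Embedded C^1 submanifold of dimension d. *)
Definition submanifold M : Prop :=
  forall x, M x -> exists (U : set 'rV[R]_d) phi,
    local_parametrization M U phi /\ (phi @` U) x.

Definition ae_on M (P : 'rV[R]_n -> Prop) : Prop :=
  (riemannian_measure d M).-negligible [set x | M x /\ ~ P x].

Definition orthogonal_to_axis (T : set 'rV[R]_n) (i : 'I_n) : Prop :=
  forall v, T v -> v *m (delta_mx 0 i : 'rV[R]_n)^T = 0.

(* x^T is the point x seen as an element of R^{n x 1}. *)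
Definition extremal M : Prop := ae_on M (fun x => exponent x^T 0 = 1%E).

Definition strongly_extremal M : Prop :=
  ae_on M (fun x => mult_exponent x^T 0 = 1%E).

Definition sim_inhom_extremal M : Prop :=
  forall theta : 'cV[R]_n, ae_on M (fun x => exponent x^T theta = 1%E).

Definition sim_inhom_strongly_extremal M : Prop :=
  forall theta : 'cV[R]_n, ae_on M (fun x => mult_exponent x^T theta = 1%E).

End extremality.

(* Main.v *)
(* Lower bound: if x is not very well approximable, then multiples of x are well
   separated on the torus, so by a Cayley graph argument (the diameter is at most
   three times the index of a ball) the points q x with |q| <= Q^(1+e) are
   Q^(-1/n+e)-dense. Hence every inhomogeneous exponent of x is at least 1.

   Upper bound: at level |q| ~ 2^t, cover the set of inhomogeneously well
   approximable points by boxes |q x_j + p_j + theta_j| < 2^(-tau_j). If two such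
   boxes, enlarged by a factor polynomial in t, come close at a point, then
   subtracting the two inequalities yields a homogeneous approximation of that
   point, which happens for infinitely many t only on a null set. The remaining
   boxes are sparse along lines on which the coordinate with the largest tau_j
   is strictly monotone, so they fill a proportion of a chart inversely
   proportional to the enlargement factor; conclude by Borel-Cantelli. Such lines
   exist because the parametrizations are immersions (all tau_j are equal in the
   extremal case) or by the hypothesis on the tangent planes. *)

(* The excess over 1 pays for the enlargement. A solution with exponent [1 + 1/(m+1)] at level [t]
   has a profile with [\sum_j tau_j >= (1 + 1/(m+1)) t - n]; the difference of two such solutions
   has size at most [2^(t+2)] and boxes larger by a polynomial in [t] only, so for large [t] it
   still beats the exponent [1 + 1/(2(m+1))]. Moving a solution from one point to another costs in
   every coordinate an error of the order of the smallest side [2^(-tau_j)], up to a polynomial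
   factor. This is harmless for the other coordinates only because that side is the smallest, and it
   dictates along which coordinate the lines are chosen. With unequal [tau_j] any coordinate may be
   the one, whence the hypothesis in (B). The measure estimate counts the cells of a finite grid met
   by a set and translates them, in place of integrating over lines, so the sets themselves need not
   be shown measurable. The lower bound is proved for the sup norm only: a product of [n] distances
   is at most the [n]-th power of their maximum, which carries it over to (B). *)
Require Import Defs.
From mathcomp Require Import all_boot all_order all_algebra.
From mathcomp Require Import all_classical all_reals all_analysis.
From mathcomp Require Import measurable_realfun.
From mathcomp Require Import ring lra zify.

Set Implicit Arguments.
Unset Strict Implicit.
Unset Printing Implicit Defensive.

Import Order.TTheory GRing.Theory Num.Theory.
Import numFieldNormedType.Exports.

Local Open Scope classical_set_scope.
Local Open Scope ring_scope.

(** * Exponents of a single vector *)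

Section nearest_integer.
Context {R : realType}.
Implicit Types (x y : R) (p : int).

Lemma norm_intr p : `|p%:~R : R| = (absz p)%:R.
Proof. by rewrite natr_absz intr_norm. Qed.

(** Distance from [y] to the nearest integer, whatever the convention at half-integers. *)
Definition nint y : R := `|centered y|.

Lemma nintE y : exists p, nint y = `|y - p%:~R|.
Proof. by exists (Num.floor (y + 2^-1)). Qed.

Lemma nint_ge0 y : 0 <= nint y.
Proof. exact: normr_ge0. Qed.

Lemma nint_le_half y : nint y <= 2^-1.
Proof.
rewrite /nint /centered ler_norml.
have /andP[h1 h2] := floor_itv (y + 2^-1).
rewrite intrD in h2.
by apply/andP; split; lra.
Qed.

Lemma nint_min y p : nint y <= `|y - p%:~R|.
Proof.
have hh := nint_le_half y.
have [p0 E] := nintE y.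
have [<-|ne] := eqVneq p0 p; first by rewrite E.
have h1 : 1 <= `|p%:~R - p0%:~R : R|.
  rewrite -intrB -intr_norm ler1z -gtz0_ge1 normr_gt0 subr_eq0.
  by rewrite eq_sym.
apply: (le_trans hh).
have := ler_normB (y - p0%:~R) (y - p%:~R).
rewrite (_ : y - p0%:~R - (y - p%:~R) = p%:~R - p0%:~R); last by ring.
rewrite -E; lra.
Qed.

Lemma nint_le_norm y : nint y <= `|y|.
Proof. by have := nint_min y 0; rewrite subr0. Qed.

Lemma nintD x y : nint (x + y) <= nint x + nint y.
Proof.
have [p ->] := nintE x; have [q ->] := nintE y.
apply: (le_trans (nint_min _ (p + q))).
apply: le_trans (ler_normD _ _); rewrite intrD.
rewrite le_eqVlt; apply/orP; left; apply/eqP; congr `|_|; ring.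
Qed.

Lemma nintN y : nint (- y) = nint y.
Proof.
suff h z : nint (- z) <= nint z.
  by apply/eqP; rewrite eq_le h -{1}[y]opprK h.
have [p ->] := nintE z; apply: (le_trans (nint_min _ (- p))).
rewrite (_ : - z - _ = - (z - p%:~R)) ?normrN//.
by rewrite intrN; ring.
Qed.

Lemma nintB x y : nint (x - y) <= nint x + nint y.
Proof. by rewrite -(nintN y); exact: nintD. Qed.

Lemma nintDz y p : nint (y + p%:~R) = nint y.
Proof.
suff h z q : nint (z + q%:~R) <= nint z.
  apply/eqP; rewrite eq_le h /=; have := h (y + p%:~R) (- p).
  by rewrite intrN addrK.
have [r ->] := nintE z; apply: (le_trans (nint_min _ (q + r))).
by rewrite intrD; rewrite le_eqVlt; apply/orP; left; apply/eqP; congr `|_|; ring.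
Qed.

Lemma nint_small y : `|y| < 2^-1 -> nint y = `|y|.
Proof.
move=> h; apply/eqP; rewrite eq_le nint_le_norm /=.
have [p E] := nintE y; rewrite E.
have [->|ne] := eqVneq p 0; first by rewrite subr0.
have h1 : 1 <= `|p%:~R : R|.
  by rewrite -intr_norm ler1z -gtz0_ge1 normr_gt0.
have := ler_normB y (y - p%:~R).
by rewrite (_ : y - _ = p%:~R); [lra|ring].
Qed.

End nearest_integer.

Section vectors.
Context {R : realType}.

Lemma normr_mx_ltP m n (A : 'M[R]_(m, n)) (e : R) : 0 < e ->
  `|A| < e <-> (forall i j, `|A i j| < e).
Proof.
move=> e0; rewrite {1}/Num.norm /= mx_normrE; split.
  by move=> /bigmax_ltP[_ h] i j; exact: (h (i, j)).
by move=> h; apply/bigmax_ltP; split=> // -[i j] _; exact: h.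
Qed.

Lemma normr_mx_leP m n (A : 'M[R]_(m, n)) (e : R) : 0 <= e ->
  `|A| <= e <-> (forall i j, `|A i j| <= e).
Proof.
move=> e0; rewrite {1}/Num.norm /= mx_normrE; split.
  by move=> /bigmax_leP[_ h] i j; exact: (h (i, j)).
by move=> h; apply/bigmax_leP; split=> // -[i j] _; exact: h.
Qed.

Lemma le_normr_mx m n (A : 'M[R]_(m, n)) i j : `|A i j| <= `|A|.
Proof. by move: i j; apply/normr_mx_leP. Qed.

(* A column vector of integers with one entry is a single integer q. *)
Definition sup_err n (x : 'rV[R]_n) (th : 'cV[R]_n) (q : int) : R :=
  (\big[Num.max/0]_(j < n) nint (q%:~R * x 0 j + th j 0)) ^+ n.

Definition prod_err n (x : 'rV[R]_n) (th : 'cV[R]_n) (q : int) : R :=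
  \prod_(j < n) nint (q%:~R * x 0 j + th j 0).

Definition int_approximable (f : int -> R) (w Q : R) :=
  exists q : int, [/\ q != 0, f q < Q `^ (- w) & `|q%:~R| <= Q].

Lemma lin_formE n (x : 'rV[R]_n) (th : 'cV[R]_n) (q : 'cV[int]_1) j :
  (x^T *m int_cV q + th) j 0 = (q 0 0)%:~R * x 0 j + th j 0.
Proof. by rewrite !mxE big_ord1 !mxE mulrC. Qed.

Lemma cV1_neq0 (q : 'cV[int]_1) : (q != 0) = (q 0 0 != 0).
Proof.
apply/idP/idP; apply: contraNN => /eqP h.
  by apply/eqP/matrixP => i j; rewrite !ord1 h mxE.
by rewrite h mxE.
Qed.

Lemma norm_int_cV1 (q : 'cV[int]_1) :
  `|int_cV q : 'cV[R]_1| = `|(q 0 0)%:~R|.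
Proof.
apply/eqP; rewrite eq_le; apply/andP; split.
  by apply/normr_mx_leP => // i j; rewrite !ord1 mxE.
by apply: le_trans (le_normr_mx _ 0 0); rewrite mxE.
Qed.

Lemma approximableE n (x : 'rV[R]_n) th (w Q : R) :
  approximable x^T th w Q <-> int_approximable (sup_err x th) w Q.
Proof.
have E (q : 'cV[int]_1) :
    dist_int (x^T *m int_cV q + th) ^+ n = sup_err x th (q 0 0).
  rewrite /dist_int /sup_err; congr (_ ^+ _).
  apply/eqP; rewrite eq_le; apply/andP; split.
    have h0 : 0 <= \big[Num.max/0]_(j < n) nint ((q 0 0)%:~R * x 0 j + th j 0).
      exact: bigmax_ge_id.
    apply/normr_mx_leP => // i j; rewrite ord1 mxE lin_formE.
    exact: (le_bigmax _ (fun j => nint ((q 0 0)%:~R * x 0 j + th j 0))).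
  apply/bigmax_leP; split=> // j _; rewrite -lin_formE.
  have := le_normr_mx (centered_mx (x^T *m int_cV q + th)) j 0.
  by rewrite [X in `|X| <= _]mxE.
split=> [[q []]|[q []]].
  rewrite cV1_neq0 E norm_int_cV1 expr1 => *.
  by exists (q 0 0).
move=> q0 h1 h2; exists (\matrix_(i, j) q).
by rewrite cV1_neq0 E norm_int_cV1 expr1 !mxE.
Qed.

(** [1 < Q] absorbs the [max 1] in [prod_plus]; [arbitrarily_large] tests no other [Q]. *)
Lemma mult_approximableE n (x : 'rV[R]_n) th (w Q : R) : 1 < Q ->
  mult_approximable x^T th w Q <-> int_approximable (prod_err x th) w Q.
Proof.
move=> Q1.
have E (q : 'cV[int]_1) :
    prod_abs (centered_mx (x^T *m int_cV q + th)) = prod_err x th (q 0 0).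
  by apply: eq_bigr => j _; rewrite mxE lin_formE.
have F (q : 'cV[int]_1) : (prod_plus q <= Q) = (`|(q 0 0)%:~R : R| <= Q).
  by rewrite /prod_plus big_ord1 mxE ge_max (ltW Q1).
split=> [[q []]|[q []]].
  rewrite cV1_neq0 E F => *.
  by exists (q 0 0).
move=> q0 h1 h2; exists (\matrix_(i, j) q).
by rewrite cV1_neq0 E F !mxE.
Qed.

Definition int_exponent (f : int -> R) : \bar R :=
  ereal_sup [set w%:E | w in
    [set w | 0 <= w /\ arbitrarily_large (int_approximable f w)]].

Lemma arbitrarily_large_iff (P P' : R -> Prop) :
  (forall Q, 1 < Q -> P Q <-> P' Q) ->
  arbitrarily_large P <-> arbitrarily_large P'.
Proof.
move=> h; split=> H Q0; have [Q [h0 h1 h2]] := H Q0;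
  by exists Q; split=> //; apply/h.
Qed.

Lemma exponentE n (x : 'rV[R]_n) th :
  exponent x^T th = int_exponent (sup_err x th).
Proof.
congr (ereal_sup (_ @` _)); apply/seteqP; split=> w /= [w0 h]; split=> //;
  by apply/(arbitrarily_large_iff _).1: h => Q Q1; rewrite approximableE.
Qed.

Lemma mult_exponentE n (x : 'rV[R]_n) th :
  mult_exponent x^T th = int_exponent (prod_err x th).
Proof.
congr (ereal_sup (_ @` _)); apply/seteqP; split=> w /= [w0 h]; split=> //;
  by apply/(arbitrarily_large_iff _).1: h => Q Q1; rewrite mult_approximableE.
Qed.

Lemma int_approximable_le (f : int -> R) (w w' Q : R) : 1 < Q -> w' <= w ->
  int_approximable f w Q -> int_approximable f w' Q.
Proof.
move=> Q1 ww' [q [q0 h1 h2]]; exists q; split=> //.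
apply: (lt_le_trans h1); rewrite ler_powR ?lerN2//; exact: ltW.
Qed.

(** Countably many exponents detect an excess over 1, so the exceptional set can be a countable
    union. *)
Lemma int_exponent_gt1 (f : int -> R) : (1 < int_exponent f)%E ->
  exists m : nat, arbitrarily_large (int_approximable f (1 + m.+1%:R^-1)).
Proof.
move=> /ereal_sup_gt[_ [w [w0 h] <-]]; rewrite lte_fin => w1.
have /ltr_add_invr[m hm] := w1.
exists m => Q0; have [Q [h1 h2 h3]] := h Q0; exists Q; split=> //.
by apply: int_approximable_le h3 => //; exact: ltW.
Qed.

Lemma int_exponent_ge1 (f : int -> R) :
  (forall w, 0 <= w -> w < 1 -> arbitrarily_large (int_approximable f w)) ->
  (1 <= int_exponent f)%E.
Proof.
move=> h; apply/lee_addgt0Pr => e e0.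
have [e1|e1] := ltP e 1; last first.
  apply: (@le_trans _ _ e%:E); first by rewrite lee_fin.
  rewrite leeDr//; apply: ereal_sup_ubound; exists 0 => //; split=> //.
  exact: h.
rewrite -leeBlDr// -EFinB; apply: ereal_sup_ubound; exists (1 - e) => //.
split; first by rewrite subr_ge0 ltW.
by apply: h; lra.
Qed.

Lemma int_exponent_le1 (f : int -> R) (w : R) : (int_exponent f <= 1)%E ->
  1 < w -> exists Q0, forall Q, Q0 < Q -> 1 < Q -> ~ int_approximable f w Q.
Proof.
move=> fle w1; apply: contrapT => /forallNP h.
suff : (w%:E <= 1)%E by rewrite lee_fin leNgt w1.
apply: le_trans fle; apply: ereal_sup_ubound; exists w => //; split.
  by rewrite ltW// (lt_trans ltr01).
move=> Q0; apply: contrapT => hQ; apply: (h Q0) => Q Q1 Q2 Q3.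
by apply: hQ; exists Q.
Qed.

Lemma int_exponent_le (f g : int -> R) : (forall q, f q <= g q) ->
  (int_exponent g <= int_exponent f)%E.
Proof.
move=> fg; apply: le_ereal_sup => _ [w [w0 h] <-]; exists w => //; split=> //.
move=> Q0; have [Q [h1 h2 [q [q0 hq hQ]]]] := h Q0; exists Q; split=> //.
by exists q; split=> //; exact: le_lt_trans hq.
Qed.

(** Through [int_exponent_le], a homogeneous multiplicative exponent at most 1 bounds the sup
    exponent by 1, and a lower bound for the inhomogeneous sup exponent passes to the multiplicative
    one. *)
Lemma prod_err_le n (x : 'rV[R]_n) th q : prod_err x th q <= sup_err x th q.
Proof.
rewrite /prod_err /sup_err -[X in _ ^+ X](card_ord n) -prodr_const.
apply: ler_prod => j _; rewrite nint_ge0 /=.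
exact: (le_bigmax _ (fun j => nint (q%:~R * x 0 j + th j 0))).
Qed.

End vectors.

(** * The lower bound *)

Section covering.
Context {R : realType} {n : nat}.
Variables (x : 'rV[R]_n) (X : nat) (c : R).
Hypotheses (X_gt0 : (0 < X)%N) (c_gt0 : 0 < c).

(* The k-fold sumset, on the torus, of the orbit segment |q| <= X of x
   thickened by a box of radius c / 2. *)
Let P (k : nat) (y : 'rV[R]_n) := exists q : int, (absz q <= k * X)%N /\
  forall j, nint (y 0 j - q%:~R * x 0 j) < k%:R * (c / 2).

Let P_le k l y : (k <= l)%N -> P k y -> P l y.
Proof.
move=> kl [q [q1 q2]]; exists q; split.
  by rewrite (leq_trans q1)// leq_mul2r kl orbT.
move=> j; apply: lt_le_trans (q2 j) _; rewrite ler_pM2r ?divr_gt0//.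
by rewrite ler_nat.
Qed.

Let P_add k l y z : P k y -> P l z -> P (k + l) (y + z).
Proof.
move=> [q [q1 q2]] [r [r1 r2]]; exists (q + r); split.
  by rewrite mulnDl; move: q1 r1; lia.
move=> j; rewrite mxE natrD mulrDl intrD.
rewrite (_ : _ - _ = (y 0 j - q%:~R * x 0 j) + (z 0 j - r%:~R * x 0 j)); last by ring.
by apply: le_lt_trans (nintD _ _) _; apply: ltrD.
Qed.

(** Truncate [q] to [[-X, X]] and split the error in the ratio [1 : k]. Thus the sets [P k] behave
    like the balls of a Cayley graph. *)
Let P_split k y : (0 < k)%N -> P k.+1 y -> exists2 z, P 1 z & P k (y - z).
Proof.
move=> k0 [q [q1 q2]].
have [r [r1 r2]] : exists r : int, (absz r <= X)%N /\ (absz (q - r) <= k * X)%N.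
  have [qX|Xq] := leqP (absz q) X; first by exists q; rewrite subrr.
  exists (Num.sg q * X%:Z); move: q1 Xq; rewrite mulSn => q1 Xq.
  have [q0|q0|q0] := ltrgt0P q.
  - by rewrite gtr0_sg// mul1r; lia.
  - by rewrite ltr0_sg// mulN1r; lia.
  - by move: Xq; rewrite q0.
have e_ex j : exists e : R, (exists p : int, y 0 j - q%:~R * x 0 j = p%:~R + e) /\
    `|e| < k.+1%:R * (c / 2).
  have [p hp] := nintE (y 0 j - q%:~R * x 0 j).
  exists (y 0 j - q%:~R * x 0 j - p%:~R); rewrite -hp; split=> //.
  by exists p; ring.
have [e he] := choice e_ex.
pose a : R := k.+1%:R^-1.
have k1 : (0 : R) < k.+1%:R by [].
have a0 : 0 < a by rewrite invr_gt0.
have ak z : z = a * (k.+1%:R * z) by rewrite mulKf// gt_eqF.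
exists (\row_j (r%:~R * x 0 j + a * e j)).
  exists r; split; first by rewrite mul1n.
  move=> j; rewrite mxE addrAC subrr add0r (le_lt_trans (nint_le_norm _))//.
  have [_ h] := he j; rewrite normrM gtr0_norm// mul1r.
  by rewrite [ltRHS]ak ltr_pM2l.
exists (q - r); split=> // j; rewrite !mxE.
have [[p hp] h] := he j.
rewrite (_ : _ - _ = a * k%:R * e j + p%:~R); last first.
  rewrite intrB (_ : y 0 j = p%:~R + e j + q%:~R * x 0 j); last by rewrite -hp; ring.
  have E := ak (e j); rewrite -natr1 in E.
  rewrite (_ : a * k%:R * e j = e j - a * e j); first by ring.
  by rewrite {2}E; ring.
rewrite nintDz (le_lt_trans (nint_le_norm _))// normrM gtr0_norm; last first.
  by rewrite mulr_gt0// ltr0n.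
rewrite [in ltRHS](ak (c / 2)) -mulrA [ltRHS]mulrCA.
by rewrite !ltr_pM2l ?ltr0n.
Qed.

(** An empty sphere stops the growth of the balls. *)
Let P_stable k : (0 < k)%N -> (forall y, P k.+1 y -> P k y) ->
  forall l y, P (k + l) y -> P k y.
Proof.
move=> k0 st; elim=> [|l IH] y; first by rewrite addn0.
rewrite addnS => /P_split[|z z1 /IH yz]; first by rewrite addn_gt0 k0.
by apply: st; rewrite -(subrK z y) -addn1; exact: P_add.
Qed.

Let P_all y : exists k, P k y.
Proof.
exists (Num.truncn (2 / c)).+1, 0; split=> // j.
apply: (le_lt_trans (nint_le_half _)).
have : 2 / c < (Num.truncn (2 / c)).+1%:R by exact: truncnS_gt.
by rewrite ltr_pdivrMr//; lra.
Qed.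

(** Index of the arc containing [v] when the circle is cut into [m.+1] equal arcs; a fractional part
    is below 1, so [inord] never takes its default value. *)
Let box m (v : R) : 'I_m.+1 :=
  inord (Num.truncn (m.+1%:R * (v - (Num.floor v)%:~R))).

Let boxP m (v w : R) : box m v = box m w -> nint (v - w) < m.+1%:R^-1.
Proof.
have m0 : (0 : R) < m.+1%:R by [].
have h (z : R) : exists p : int,
    (box m z : nat)%:R <= m.+1%:R * (z - p%:~R) < (box m z : nat).+1%:R.
  exists (Num.floor z).
  have /andP[z1 z2] := floor_itv z; rewrite intrD in z2.
  have z3 : 0 <= m.+1%:R * (z - (Num.floor z)%:~R).
    by rewrite mulr_ge0// subr_ge0.
  rewrite /box inordK; first exact: truncn_itv.
  rewrite -(ltr_nat R); apply: (@le_lt_trans _ _ (m.+1%:R * (z - (Num.floor z)%:~R))).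
    by rewrite truncn_le.
  by rewrite gtr_pMr//; lra.
have [p /andP[p1 p2]] := h v; have [q /andP[q1 q2]] := h w.
move=> E; rewrite -E in q1 q2.
apply: (le_lt_trans (nint_min _ (p - q))).
rewrite intrB -[ltRHS]mul1r ltr_pdivlMr// -[X in _ * X](gtr0_norm m0) -normrM.
rewrite -[(box m v).+1%:R]natr1 in p2 q2.
by rewrite ltr_norml; apply/andP; split; lra.
Qed.

(* In a connected Cayley graph, points of the spheres of radii congruent to 1
   modulo 3 have disjoint unit balls, so the diameter is at most three times
   the index of a ball. *)
Lemma orbit_covering (N m : nat) (y : 'rV[R]_n) :
  (forall q : int, q != 0 -> (absz q <= X)%N ->
     exists j, c <= nint (q%:~R * x 0 j)) ->
  m.+1%:R^-1 <= c -> (m.+1 ^ n < N * X.+1)%N ->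
  exists q : int, (absz q <= 3 * N * X)%N /\
    forall j, nint (y 0 j - q%:~R * x 0 j) < (3 * N)%:R * (c / 2).
Proof.
move=> sep mc; rewrite ltnNge => /negP big; apply: contrapT => Py; apply: big.
(* For [i < N] the shell between these two balls is nonempty: otherwise the ball of radius
   [3 * i + 1] would be everything and [y] would be reached within [3 * N] steps. *)
have t_ex i : exists t, (i < N)%N -> P (3 * i + 2) t /\ ~ P (3 * i + 1) t.
  have [iN|iN] := ltnP i N; last by exists 0.
  apply: contrapT => /forallNP nt; apply: Py.
  have [k Pk] := P_all y.
  apply: (@P_le (3 * i + 1)); first by lia.
  apply: (@P_stable _ _ _ k); first by lia.
    move=> z z1; apply: contrapT => z2; apply: (nt z) => _; split=> //.
    by move: z1; rewrite -addnS.
  by apply: P_le Pk; lia.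
have [t ht] := choice t_ex.
(* [N * X.+1] points fall into the [m.+1 ^ n] boxes of the torus; injectivity of [F] will contradict
   the assumed inequality. *)
pose pt (a : 'I_N * 'I_X.+1) j := t a.1 0 j + (a.2 : nat)%:~R * x 0 j.
pose F (a : 'I_N * 'I_X.+1) := [ffun j : 'I_n => box m (pt a j)].
have FP a b : F a = F b -> forall j, nint (pt a j - pt b j) < c.
  move=> /ffunP ab j; apply: lt_le_trans mc; apply: boxP.
  by have := ab j; rewrite !ffunE.
(* A collision puts [t a.1] within two steps of [t b.1], hence in the ball of radius
   [3 * b.1 + 4 <= 3 * a.1 + 1]. *)
have Fne a b : F a = F b -> (b.1 < a.1)%N -> False.
  move=> /FP ab ba; have [_ na] := ht a.1 (ltn_ord a.1).
  have [Pb _] := ht b.1 (ltn_ord b.1); apply: na.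
  apply: (@P_le (3 * b.1 + 2 + 2)); first by lia.
  rewrite -[t a.1](subrK (t b.1)) addrC; apply: P_add => //.
  exists ((b.2 : nat)%:Z - (a.2 : nat)%:Z); split.
    by have := ltn_ord b.2; have := ltn_ord a.2; lia.
  move=> j; have := ab j; rewrite /pt !mxE intrB => h.
  rewrite (_ : _ * (c / 2) = c); last by field.
  by apply: le_lt_trans h; rewrite le_eqVlt; apply/orP; left; apply/eqP; congr nint; ring.
have Finj : injective F.
  move=> a b ab; have ab1 : a.1 = b.1.
    by case: (ltngtP (a.1 : nat) b.1) => [/(Fne _ _ (esym ab))|/(Fne _ _ ab)|/val_inj].
  apply/eqP; rewrite (surjective_pairing a) (surjective_pairing b) ab1.
  rewrite xpair_eqE eqxx /=; apply: contraT => ne.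
  have [||j] := sep ((a.2 : nat)%:Z - (b.2 : nat)%:Z).
  - by rewrite subr_eq0; apply: contra ne => /eqP[] /val_inj ->.
  - by have := ltn_ord b.2; have := ltn_ord a.2; lia.
  rewrite leNgt; apply: contraTeq => _; rewrite negbK.
  have := FP _ _ ab j; rewrite /pt ab1 intrB => h.
  by apply: le_lt_trans h; rewrite le_eqVlt; apply/orP; left; apply/eqP; congr nint; ring.
by have := leq_card F Finj; rewrite card_prod card_ffun !card_ord.
Qed.

End covering.

Section lower_bound.
Context {R : realType} {n : nat}.
Hypothesis n_gt0 : (0 < n)%N.

Lemma sup_err_lt (x : 'rV[R]_n) (th : 'cV[R]_n) q (s : R) : 0 < s ->
  (forall j, nint (q%:~R * x 0 j + th j 0) < s) -> sup_err x th q < s ^+ n.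
Proof.
move=> s0 h; rewrite /sup_err ltrXn2r// ?bigmax_ge_id -?lt0n// ?ltW//.
by apply/bigmax_ltP.
Qed.

Lemma inhom_lower_bound (x : 'rV[R]_n) (th : 'cV[R]_n) (w : R) :
  (int_exponent (sup_err x 0) <= 1)%E -> 0 <= w -> w < 1 ->
  arbitrarily_large (int_approximable (sup_err x th) w).
Proof.
move=> hom w0 w1 Q0.
have nR : (0 : R) < n%:R by rewrite ltr0n.
(* Makes [e * n = (1 - w) / 2], a loss small enough to keep [dl] positive. *)
pose e : R := (1 - w) / (2 * n%:R).
have e0 : 0 < e by rewrite divr_gt0 ?mulr_gt0// subr_gt0.
have en : e * n%:R = (1 - w) / 2 by rewrite /e; field; rewrite gt_eqF.
have [|Q1 hQ1] := int_exponent_le1 hom (w := 1 + e); first by lra.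
pose B : R := 2 ^+ n.+1.
have B1 : 1 <= B by rewrite exprn_ege1// ler1n.
(* [dl] is the power of [X] left over when [(3 * B * X^e * c)^n] is compared with [Q^(-w)]; [A]
   collects the constants of that comparison. *)
pose A : R := (3 * B) ^+ n * (7 * B) `^ w.
pose dl : R := (1 + e) * (1 - w) - e * n%:R.
have dl0 : 0 < dl.
  have : 0 <= e * (1 - w) by rewrite mulr_ge0 ?ltW// subr_gt0.
  by rewrite /dl en; lra.
have A0 : 0 <= A by rewrite mulr_ge0 ?powR_ge0// exprn_ge0// mulr_ge0//; lra.
pose X := (Num.truncn (`|Q0| + `|Q1| + A `^ dl^-1)).+2.
have XR : `|Q0| + `|Q1| + A `^ dl^-1 < X%:R.
  apply: (lt_trans (truncnS_gt _)).
  by rewrite ltr_nat.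
have hA : 0 <= A `^ dl^-1 by exact: powR_ge0.
have [hq0 hq1] : 0 <= `|Q0| /\ 0 <= `|Q1| by [].
have [Q0l Q1l] : Q0 <= `|Q0| /\ Q1 <= `|Q1| by rewrite !ler_norm.
have X1 : (1 : R) < X%:R by rewrite ltr1n.
have X0 : (0 : R) < X%:R by rewrite ltr0n.
have X0n : (0 < X)%N by [].
clearbody X.
have XA : A <= X%:R `^ dl.
  have -> : A = (A `^ dl^-1) `^ dl.
    by rewrite -powRrM mulVf ?lt0r_neq0// powRr1.
  by apply: ge0_ler_powR; rewrite ?nnegrE//; lra.
pose c : R := X%:R `^ (- ((1 + e) / n%:R)).
have c0 : 0 < c by rewrite powR_gt0.
have cn : c ^+ n = X%:R `^ (- (1 + e)).
  rewrite -powR_mulrn ?ltW// -powRrM; congr (_ `^ _); field.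
  by rewrite gt_eqF.
have c1 : c <= 1.
  rewrite -(powRr0 X%:R) ler_powR ?(ltW X1)// oppr_le0 divr_ge0// ?ltW//; lra.
clearbody c.
have sep (q : int) : q != 0 -> (absz q <= X)%N ->
    exists j, c <= nint (q%:~R * x 0 j).
  move=> q0 qX; apply: contrapT => /forallNP h.
  apply: (hQ1 X%:R); rewrite ?X1//; first by lra.
  exists q; split=> //.
    rewrite -cn; apply: sup_err_lt => // j; rewrite mxE addr0 ltNge.
    exact/negP.
  by rewrite norm_intr ler_nat.
pose m := Num.truncn c^-1.
have mc : m.+1%:R^-1 <= c.
  rewrite -[leRHS]invrK lef_pV2 ?posrE ?invr_gt0 ?ltr0n//.
  by apply: ltW; exact: truncnS_gt.
have mc2 : m.+1%:R <= 2 / c.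
  have h1 : 1 <= c^-1 by rewrite invf_ge1.
  have : m%:R <= c^-1 by rewrite truncn_le// ltW ?invr_gt0.
  by rewrite -natr1; lra.
pose Xe : R := X%:R `^ e.
have Xe1 : 1 <= Xe by rewrite -(powRr0 X%:R) ler_powR ?(ltW X1)// ltW.
(* [N * X] has to exceed [(2 / c)^n = 2^n * X^(1 + e)], an upper bound for the number of boxes. *)
pose N := (Num.truncn (2 ^+ n * Xe)).+1.
have N1 : 2 ^+ n * Xe < N%:R by exact: truncnS_gt.
have h2n : (1 : R) <= 2 ^+ n by rewrite exprn_ege1// ler1n.
have h2X : 1 <= 2 ^+ n * Xe by rewrite mulr_ege1.
have NB : N%:R <= B * Xe.
  have : (Num.truncn (2 ^+ n * Xe))%:R <= 2 ^+ n * Xe by rewrite truncn_le//; lra.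
  by rewrite /N -natr1 /B exprS; lra.
have N0 : (0 < N)%N by [].
clearbody m N B.
have big : (m.+1 ^ n < N * X.+1)%N.
  rewrite -(ltr_nat R) natrX natrM.
  apply: (@le_lt_trans _ _ ((2 / c) ^+ n)).
    by rewrite lerXn2r ?nnegrE// divr_ge0// ltW.
  rewrite expr_div_n cn -powRN opprK powRD ?(gt_eqF X0) ?implybT//.
  rewrite powRr1 ?ltW// -/Xe.
  apply: (@lt_le_trans _ _ (N%:R * X%:R)); last by rewrite ler_pM2l ?ler_nat ?ltr0n.
  by rewrite mulrCA [ltRHS]mulrC ltr_pM2l.
(* The covering does not exclude [q = 0]. Shifting the target by [q0 * x] yields the multiplier
   [q0 + q], which is positive and at most [6 * N * X + 1 <= 7 * N * X]: hence the 7 in [Q]. *)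
pose q0 : nat := (3 * N * X).+1.
have [q [q1 q2]] := @orbit_covering _ _ x X c X0n c0 N m
  (\row_j (- th j 0 - q0%:R * x 0 j)) sep mc big.
pose Q : R := 7 * B * (X%:R * Xe).
have XQ : X%:R <= Q.
  apply: (@le_trans _ _ (X%:R * Xe)); first by rewrite ler_peMr// ltW.
  by rewrite ler_peMl ?mulr_ge0 ?ltW//; lra.
have Qw : (3 * N%:R * c) ^+ n <= Q `^ (- w).
  have -> : Q `^ (- w) = ((7 * B) `^ w)^-1 * X%:R `^ (- ((1 + e) * w)).
    rewrite /Q powRM//; [|by lra|by rewrite mulr_ge0 ?powR_ge0// ltW].
    rewrite powRN -mulrN powRrM powRD ?(gt_eqF X0) ?implybT//.
    by rewrite powRr1 ?ltW.
  apply: (@le_trans _ _ ((3 * B * Xe * c) ^+ n)).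
    rewrite lerXn2r ?nnegrE ?mulr_ge0//; [by rewrite ltW|by lra|by rewrite powR_ge0|by rewrite ltW|].
    by rewrite ler_pM2r//; lra.
  rewrite !exprMn cn -(powR_mulrn n (powR_ge0 X%:R e)) -powRrM.
  rewrite ler_pdivlMl ?powR_gt0//; last by lra.
  rewrite -mulrA -powRD ?(gt_eqF X0) ?implybT// mulrA -exprMn [_ * (3 * B) ^+ n]mulrC -/A.
  rewrite (_ : - ((1 + e) * w) = dl + (e * n%:R + - (1 + e))); last by rewrite /dl; ring.
  by rewrite [leRHS]powRD ?(gt_eqF X0) ?implybT// ler_pM2r ?powR_gt0.
exists Q; split; [by lra|by lra|].
exists (q0%:Z + q); split.
- by rewrite /q0; clear -q1; lia.
- apply: lt_le_trans Qw; apply: sup_err_lt => [|j].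
    by rewrite !mulr_gt0// ltr0n.
  have := q2 j; rewrite mxE -nintN intrD natrM => h.
  rewrite (_ : _ + _ = - (- th j 0 - q0%:R * x 0 j - q%:~R * x 0 j)); last first.
    by rewrite -pmulrn; ring.
  apply: (lt_le_trans h).
  have : 0 <= 3 * N%:R * c by rewrite !mulr_ge0// ltW.
  by lra.
- apply: (@le_trans _ _ (7 * N * X)%:R).
    rewrite norm_intr ler_nat /q0.
    have : (0 < N * X)%N by rewrite muln_gt0 N0 X0n.
    by move: q1; rewrite -!mulnA; move: (N * X)%N => z; clear; lia.
  by have := ler_wpM2r (ltW X0) NB; rewrite !natrM /Q; lra.
Qed.

End lower_bound.

(** * Grids and null sets *)

Section tuple_measure.
Context {R : realType}.
Local Notation mu := (@lebesgue_tuple R).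

Definition tuple_box d (a : 'I_d -> R) (r : R) : set (d.-tuple (measurableTypeR R)) :=
  [set t | forall i, a i <= tnth t i < a i + r].

Lemma measurable_tuple_box d (a : 'I_d -> R) r : measurable (tuple_box a r).
Proof.
have -> : tuple_box a r = \bigcap_(i in [set: 'I_d])
    ((fun t : d.-tuple (measurableTypeR R) => tnth t i) @^-1` `[a i, a i + r[%classic).
  apply/seteqP; split=> t /= h i => [_|]; first by rewrite /= in_itv/= h.
  by have := h i I; rewrite /= in_itv.
apply: fin_bigcap_measurable => [|i _]; first exact: finite_finset.
rewrite -[X in measurable X]setTI.
by apply: (@measurable_tnth _ (measurableTypeR R) d i) => //; exact: measurable_itv.
Qed.

Lemma lebesgue_tuple_box d (a : 'I_d -> R) r : 0 <= r ->
  mu d (tuple_box a r) = (r ^+ d)%:E.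
Proof.
move=> r0; elim: d a => [|d IH] a.
  rewrite /= diracE mem_set ?expr0//; by case.
rewrite exprS EFinM.
pose a' i := a (lift ord0 i).
have -> : tuple_box a r = [set t : d.+1.-tuple (measurableTypeR R) |
    `[a ord0, a ord0 + r[%classic (thead t) /\
    tuple_box a' r [tuple of behead t]].
  apply/seteqP; split=> t /=.
    move=> h; split; first by rewrite in_itv/=; exact: h.
    by move=> i; rewrite tnth_behead (_ : inord _ = lift ord0 i) ?h//;
      apply/val_inj; rewrite /= inordK// ltnS.
  rewrite /= in_itv/= => -[h0 h] i; case: (unliftP ord0 i) => [j ->|->].
    have := h j; rewrite tnth_behead (_ : inord _ = lift ord0 j)//.
    by apply/val_inj; rewrite /= inordK// ltnS.
  exact: h0.
rewrite lebesgue_tupleS; [|exact: measurable_itv|exact: measurable_tuple_box].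
rewrite IH lebesgue_measure_itv /= lte_fin ltrDl; case: ltP => [_|].
  by rewrite -EFinD addrAC subrr add0r.
by move=> r1; have -> : r = 0 by apply/eqP; rewrite eq_le r0 r1.
Qed.

Lemma measure_bigU_le dd (T : measurableType dd) (m : {measure set T -> \bar R})
    (I : eqType) (s : seq I) (F : I -> set T) (v : R) :
  (forall i, i \in s -> measurable (F i) /\ (m (F i) <= v%:E)%E) ->
  measurable (\big[setU/set0]_(i <- s) F i) /\
  (m (\big[setU/set0]_(i <- s) F i) <= ((size s)%:R * v)%:E)%E.
Proof.
elim: s => [|i s IH] h; first by rewrite big_nil measure0 mul0r.
rewrite big_cons.
have [|m1 m2] := IH; first by move=> j js; apply: h; rewrite inE js orbT.
have [|m3 m4] := h i; first by rewrite inE eqxx.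
split; first exact: measurableU.
apply: (le_trans (measureU2 _ _ _)) => //=.
by rewrite -natr1 mulrDl mul1r addrC EFinD; exact: leeD.
Qed.

(* The translates by m * step in direction i, m < M, of the set of grid cells
   met by S are pairwise disjoint. *)
Lemma grid_cover d (S : set 'rV[R]_d) (a : 'rV[R]_d) (r : R) (L M step : nat) (i : 'I_d) :
  0 < r -> (0 < M)%N -> (M * step <= L)%N ->
  (forall u, S u -> forall l, a 0 l <= u 0 l < a 0 l + L%:R * r) ->
  (forall u v, S u -> S v -> (forall l, l != i -> `|u 0 l - v 0 l| <= r) ->
     `|u 0 i - v 0 i| <= (M * step).+1%:R * r ->
     `|u 0 i - v 0 i| < (step%:R - 1) * r) ->
  exists E, [/\ measurable E, [set t | S (row_of_tuple t)] `<=` E &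
    (mu d E <= ((2 * L)%:R ^+ d * r ^+ d / M%:R)%:E)%E].
Proof.
move=> r0 M0 ML Sbox gap.
pose cell (k : {ffun 'I_d -> 'I_L}) (u : 'rV[R]_d) :=
  forall l, a 0 l + (k l : nat)%:R * r <= u 0 l < a 0 l + (k l : nat)%:R * r + r.
pose G := [set k | `[< exists2 u, S u & cell k u >]]%SET.
have cell_dist k k' u u' l : cell k u -> cell k' u' ->
    `|u 0 l - u' 0 l - ((k l : nat)%:R - (k' l : nat)%:R) * r| < r.
  move=> /(_ l)/andP[h1 h2] /(_ l)/andP[h3 h4].
  by rewrite ltr_norml; apply/andP; split; lra.
have cardG : (#|G| * M <= (2 * L) ^ d)%N.
  (* A translate leaves the grid by at most [M * step <= L] cells, hence the range [2 * L]. *)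
  have lt2L (k : {ffun 'I_d -> 'I_L}) (m : 'I_M) (l : 'I_d) :
      (k l + (l == i) * (m * step) < 2 * L)%N.
    have h1 := ltn_ord (k l); have h2 := ltn_ord m.
    have h3 : (m * step <= M * step)%N by rewrite leq_mul2r ltnW ?orbT.
    by case: (l == i); lia.
  pose F (p : {ffun 'I_d -> 'I_L} * 'I_M) : {ffun 'I_d -> 'I_(2 * L)} :=
    [ffun l => Ordinal (lt2L p.1 p.2 l)].
  have Finj : {in finset.setX G [set: 'I_M]%SET &, injective F}.
    move=> [k m] [k' m']; rewrite !inE /= !andbT.
    move=> /asboolP[u Su ku] /asboolP[u' Su' ku'] /ffunP E.
    have E' l : (k l + (l == i) * (m * step) = k' l + (l == i) * (m' * step))%N.
      by have := E l; rewrite !ffunE => /(congr1 val).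
    have Ei := E' i; rewrite eqxx !mul1n in Ei.
    have El l : l != i -> k l = k' l.
      by move=> li; apply/val_inj; have := E' l; rewrite (negbTE li) !addn0.
    have EiR : (k i : nat)%:R - (k' i : nat)%:R = ((m' : nat)%:R - (m : nat)%:R) * step%:R :> R.
      move/(congr1 (fun z : nat => z%:R : R)) : Ei.
      by rewrite !natrD !natrM => Ei; lra.
    have hd := cell_dist _ _ _ _ i ku ku'.
    (* Distinct translates would put [u] and [u'] between [step - 1] and [M * step + 1] cells apart
       in direction [i], which the gap hypothesis excludes. *)
    have mm : m = m'.
      apply/val_inj/eqP; apply: contraT => ne.
      have [n1 n2] : 1 <= `|(m' : nat)%:R - (m : nat)%:R : R| /\
          `|(m' : nat)%:R - (m : nat)%:R : R| <= M%:R.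
        have -> : `|(m' : nat)%:R - (m : nat)%:R : R| = (absz ((m':nat)%:Z - (m:nat)%:Z))%:R.
          by rewrite -norm_intr intrB.
        rewrite (ler_nat R 1) ler_nat.
        by have := ltn_ord m; have := ltn_ord m'; move: ne => /eqP /=; lia.
      pose z := ((m' : nat)%:R - (m : nat)%:R) * step%:R * r.
      have zn : `|z| = `|(m' : nat)%:R - (m : nat)%:R| * (step%:R * r).
        by rewrite /z -mulrA normrM [X in _ * X]ger0_norm// mulr_ge0// ltW.
      have sr0 : 0 <= step%:R * r by rewrite mulr_ge0// ltW.
      have z1 : step%:R * r <= `|z| by rewrite zn ler_peMl.
      have z2 : `|z| <= M%:R * (step%:R * r) by rewrite zn ler_wpM2r.
      rewrite EiR -/z in hd.
      have t1 := ler_normD (u 0 i - u' 0 i - z) z.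
      have t2 := ler_normB (u 0 i - u' 0 i) (u 0 i - u' 0 i - z).
      rewrite subrK in t1; rewrite subKr in t2.
      have gp : `|u 0 i - u' 0 i| < (step%:R - 1) * r.
        apply: gap => // [l li|]; last by rewrite -natr1 natrM; lra.
        have := cell_dist _ _ _ _ l ku ku'.
        by rewrite El// subrr mul0r subr0 => /ltW.
      by lra.
    rewrite mm in Ei *; congr pair; apply/ffunP => l.
    have [->|/El//] := eqVneq l i.
    by move/eqP: Ei; rewrite eqn_add2r => /eqP/ord_inj.
  have := card_in_imset Finj; rewrite finset.cardsX finset.cardsT card_ord => <-.
  by rewrite (leq_trans (max_card _))// card_ffun !card_ord.
pose B (k : {ffun 'I_d -> 'I_L}) := tuple_box (fun l => a 0 l + (k l : nat)%:R * r) r.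
have [|mE leE] := @measure_bigU_le _ _ (mu d) _ (enum G) B (r ^+ d).
  move=> k _; split; first exact: measurable_tuple_box.
  by rewrite -(lebesgue_tuple_box (fun l => a 0 l + (k l : nat)%:R * r) (ltW r0)).
exists (\big[setU/set0]_(k <- enum G) B k); split=> //.
  move=> t /= St; rewrite -bigcup_seq.
  pose u : 'rV[R]_d := row_of_tuple t.
  have kP l : exists k : 'I_L, a 0 l + (k : nat)%:R * r <= u 0 l < a 0 l + (k : nat)%:R * r + r.
    have /andP[h1 h2] := Sbox _ St l.
    pose z := (u 0 l - a 0 l) / r.
    have z0 : 0 <= z by rewrite divr_ge0 ?subr_ge0// ltW.
    have /andP[z1 z2] := truncn_itv z0.
    have zL : (Num.truncn z < L)%N.
      rewrite -(ltr_nat R) (le_lt_trans z1)// ltr_pdivrMr//; rewrite /u; lra.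
    exists (Ordinal zL) => /=.
    move: z1 z2; rewrite ler_pdivlMr// ltr_pdivrMr// -natr1 /u => z1 z2.
    by apply/andP; split; lra.
  have [k hk] := choice kP.
  exists (finfun k) => /=.
    rewrite mem_enum inE; apply/asboolP; exists u => // l.
    by rewrite ffunE.
  by move=> l; rewrite ffunE; have := hk l; rewrite mxE.
apply: (le_trans leE); rewrite lee_fin -cardE ler_pdivlMr ?ltr0n//.
rewrite mulrAC ler_pM2r ?exprn_gt0//.
by rewrite -natrM -natrX ler_nat.
Qed.

Definition null d (S : set 'rV[R]_d) := (mu d).-negligible [set t | S (row_of_tuple t)].

Lemma null_bigcup d (F : nat -> set 'rV[R]_d) :
  (forall k, null (F k)) -> null (\bigcup_k F k).
Proof. by move=> h; exact: negligible_bigcup. Qed.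

Lemma null_sub d (A B : set 'rV[R]_d) : A `<=` B -> null B -> null A.
Proof. by move=> AB; apply: negligibleS => t; exact: AB. Qed.

(** Borel-Cantelli; the partial sums telescope to [C - C / N.+1]. *)
Lemma null_limsup d (S : nat -> set 'rV[R]_d) (C : R) (T0 : nat) : 0 <= C ->
  (forall t : nat, (T0 <= t)%N -> exists E, [/\ measurable E,
     [set x | S t (row_of_tuple x)] `<=` E &
     (mu d E <= (C / (t.+1 * t.+2)%:R)%:E)%E]) ->
  null [set u | forall T, exists2 t, (T <= t)%N & S t u].
Proof.
move=> C0 h.
have E_ex (t : nat) : exists E, [/\ measurable E,
     (T0 <= t)%N -> [set x | S t (row_of_tuple x)] `<=` E &
     (mu d E <= (C / (t.+1 * t.+2)%:R)%:E)%E].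
  have [Tt|tT] := leqP T0 t; first by have [E [? ? ?]] := h t Tt; exists E.
  by exists set0; rewrite measure0 lee_fin divr_ge0.
have [E hE] := choice E_ex.
exists (lim_sup_set E); split.
- apply: bigcap_measurable => // k _; apply: bigcup_measurable => l _.
  by have [] := hE l.
- apply: lim_sup_set_cvg0; first by move=> k; have [] := hE k.
  apply: (@le_lt_trans _ _ C%:E); last exact: ltry.
  apply: lime_le; first by apply: is_cvg_nneseries => *; exact: measure_ge0.
  apply: nearW => N; apply: (@le_trans _ _ (\sum_(0 <= t < N) (C / (t.+1 * t.+2)%:R)%:E)%E).
    by apply: lee_sum => t _; have [] := hE t.
  rewrite sumEFin lee_fin.
  have -> : \sum_(0 <= t < N) C / (t.+1 * t.+2)%:R = C - C / N.+1%:R.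
    elim: N => [|N IH]; first by rewrite big_nil divr1 subrr.
    rewrite big_nat_recr//= IH natrM -(natr1 N.+1); field.
    by have := ler0n R N => h0; apply/andP; split; apply: lt0r_neq0; lra.
  by rewrite gerBl divr_ge0.
- move=> x /= hx T _; have [t tT St] := hx (maxn T T0).
  exists t; first by rewrite /= (leq_trans _ tT)// leq_maxl.
  by have [_ + _] := hE t; apply=> //; rewrite (leq_trans _ tT)// leq_maxr.
Qed.

End tuple_measure.

Section growth.
Context {R : realType}.

(** The Taylor term of degree [p.+1] of the exponential already outgrows the left side. *)
Lemma poly_lt_powR (B b : R) (p : nat) : 0 < b ->
  exists T : nat, forall t : nat, (T <= t)%N -> B * t.+1%:R ^+ p < 2 `^ (b * t%:R).
Proof.
move=> b0.
pose c := b * ln 2.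
have ln2 : 0 < ln (2 : R) by rewrite ln_gt0// ltr1n.
have c0 : 0 < c by rewrite mulr_gt0.
pose K := c ^+ p.+1 / (p.+1)`!%:R.
have K0 : 0 < K by rewrite divr_gt0 ?exprn_gt0// ltr0n fact_gt0.
pose B' := `|B| * 2 ^+ p.
exists (Num.truncn (B' / K)).+1 => t Tt.
have t1 : B' / K < t%:R.
  by apply: (lt_le_trans (truncnS_gt _)); rewrite ler_nat.
have t0 : (0 < t)%N by apply: leq_trans Tt.
have tR : (1 : R) <= t%:R by rewrite ler1n.
have -> : 2 `^ (b * t%:R) = expR (c * t%:R).
  by rewrite /powR ifF ?pnatr_eq0// /c mulrAC.
apply: (@le_lt_trans _ _ (B' * t%:R ^+ p)).
  apply: (@le_trans _ _ (`|B| * t.+1%:R ^+ p)).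
    by rewrite ler_wpM2r ?exprn_ge0// ler_norm.
  rewrite /B' -mulrA ler_wpM2l// -exprMn lerXn2r ?nnegrE//.
  by rewrite -natr1; lra.
apply: (@lt_le_trans _ _ (K * t%:R ^+ p.+1)).
  rewrite exprS mulrA ltr_pM2r ?exprn_gt0//; last by lra.
  by rewrite mulrC -ltr_pdivrMr.
have ct : 0 <= c * t%:R by rewrite mulr_ge0// ltW.
apply: le_trans (expR_ge1Dxn p ct).
by rewrite exprMn /K mulrAC lerDr.
Qed.

Lemma poly_lt_exp2 (B : R) (p : nat) :
  exists T : nat, forall t : nat, (T <= t)%N -> B * t.+1%:R ^+ p < 2 ^+ t.
Proof.
have [T h] := poly_lt_powR B p (@ltr01 R).
by exists T => t /h; rewrite mul1r powR_mulrn.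
Qed.

End growth.

(** * Transference in a cube *)

Section local_transference.
Context {R : realType} {d n : nat}.

Definition cube (a : 'rV[R]_d) (l : R) : set 'rV[R]_d :=
  [set u | forall k, a 0 k <= u 0 k < a 0 k + l].

(** Derivative-free form of what a [C^1] map satisfies near a point. In the second clause [phi_j]
    separates points along direction [i] at a linear rate, uniformly on [D], and [e] bounds the
    displacement in the other directions. *)
Definition tame (phi : 'rV[R]_d -> 'rV[R]_n) (good : set 'I_n) (D : set 'rV[R]_d) (c C : R) :=
  (forall u v j e, D u -> D v -> 0 <= e -> (forall k, `|u 0 k - v 0 k| <= e) ->
     `|phi u 0 j - phi v 0 j| <= C * e) /\
  (forall j, good j -> exists i, forall u v e, D u -> D v -> 0 <= e ->
     (forall k, k != i -> `|u 0 k - v 0 k| <= e) ->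
     c * `|u 0 i - v 0 i| <= `|phi u 0 j - phi v 0 j| + C * e).

(* Subexponential in t, hence harmless for the homogeneous exponent; but dividing
   by it makes the measures summable over t, even after a union over the at most
   (2 t + 1) ^ n profiles tau. *)
Definition enlargement t : nat := ((2 * t).+1 ^ n * (t.+1 * t.+2))%N.

Definition bad (th : 'cV[R]_n) t (tau : {ffun 'I_n -> 'I_(2 * t).+1}) (x : 'rV[R]_n) :=
  exists q : int, (2 ^ t <= absz q < 2 ^ t.+1)%N /\
    forall j, nint (q%:~R * x 0 j + th j 0) < 2^-1 ^+ tau j.

(** Shape of the difference of two [bad] solutions at nearby points; [2 ^ t.+2] bounds the
    difference of two integers below [2 ^ t.+1]. *)
Definition bad_hom (K : R) t (tau : {ffun 'I_n -> 'I_(2 * t).+1}) (x : 'rV[R]_n) :=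
  exists r : int, [/\ r != 0, (absz r <= 2 ^ t.+2)%N &
    forall j, nint (r%:~R * x 0 j) < K * (enlargement t)%:R * 2^-1 ^+ tau j].

Variables (phi : 'rV[R]_d -> 'rV[R]_n) (good : set 'I_n).
Variables (a : 'rV[R]_d) (l c C : R).
Hypotheses (l0 : 0 < l) (c0 : 0 < c) (C0 : 0 <= C).
Hypothesis phi_tame : tame phi good (cube a l) c C.

(** Two bad points with the same [q] will lie within [(2 + C) * r / c] of each other along a column;
    [step] makes this less than [step - 1] cells. *)
Let step : nat := (Num.truncn ((2 + C) / c)).+2.

Let stepP (r : R) : 0 < r -> (2 + C) * r / c < (step%:R - 1) * r.
Proof.
move=> r0; rewrite mulrAC ltr_pM2r//.
have -> : step%:R = (Num.truncn ((2 + C) / c)).+1%:R + 1 :> R by rewrite natr1.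
rewrite addrK; exact: truncnS_gt.
Qed.

Let tile (r : R) (M : nat) : 0 < r -> (0 < M)%N -> (M * step)%:R * r <= l ->
  exists L : nat, [/\ (M * step <= L)%N,
    forall u, cube a l u -> forall k, a 0 k <= u 0 k < a 0 k + L%:R * r &
    (2 * L)%:R ^+ d * r ^+ d <= (4 * l) ^+ d].
Proof.
move=> r0 M0 Ml; exists (Num.truncn (l / r)).+1.
have L1 : l / r < (Num.truncn (l / r)).+1%:R by exact: truncnS_gt.
have L2 : (Num.truncn (l / r))%:R <= l / r.
  by rewrite truncn_le// divr_ge0// ltW.
rewrite ltr_pdivrMr// in L1; rewrite ler_pdivlMr// in L2.
split.
- by rewrite -(ler_nat R) -(ler_pM2r r0) (le_trans Ml)// ltW.
- by move=> u Du k; have /andP[-> h] := Du k; rewrite (lt_le_trans h)// lerD2l ltW.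
(* Rounding up costs at most one cell: [2 * L * r <= 2 * (l + r) <= 4 * l]. *)
have rl : r <= l.
  apply: le_trans Ml; rewrite ler_peMl//; first exact: ltW.
  by rewrite ler1n muln_gt0 M0.
rewrite -exprMn lerXn2r ?nnegrE ?mulr_ge0//; [exact: ltW|exact: ltW|].
by rewrite natrM -natr1; lra.
Qed.

(** Along a column a level set spreads over boundedly many cells, so its measure is at most
    [(4 * l) ^ d / M] for every [M]. This handles the points that one fixed [q] approximates with
    error 0. *)
Lemma level_set_null (j : 'I_n) (z : R) : good j ->
  null [set u | cube a l u /\ phi u 0 j = z].
Proof.
move=> gj; have [i hi] := phi_tame.2 j gj.
pose S := [set u | cube a l u /\ phi u 0 j = z].
apply: (@null_sub _ _ _ [set u | forall T : nat, exists2 t, (T <= t)%N & S u]).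
  by move=> u Su T; exists T.
apply: (@null_limsup _ _ (fun=> S) ((4 * l) ^+ d) 0).
  by rewrite exprn_ge0// mulr_ge0// ltW.
move=> t _; pose M := (t.+1 * t.+2)%N.
pose r := l / (M * step)%:R.
have Ms : (0 : R) < (M * step)%:R by rewrite ltr0n.
have r0 : 0 < r by rewrite divr_gt0.
have M0 : (0 < M)%N by [].
have [|L [L1 L2 L3]] := @tile r M r0 M0.
  by rewrite /r mulrC divfK// gt_eqF.
have [||E [E1 E2 E3]] := @grid_cover _ d S a r L M step i r0 M0 L1.
- by move=> u [Du _]; exact: L2.
- move=> u v [Du uz] [Dv vz] uv _; apply: le_lt_trans (stepP r0).
  have := hi u v r Du Dv (ltW r0) uv.
  rewrite uz vz subrr normr0 add0r ler_pdivlMr// mulrC => /le_trans; apply.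
  by rewrite ler_pM2r//; lra.
exists E; split=> //; apply: (le_trans E3).
by rewrite lee_fin ler_pM2r// invr_gt0 ltr0n.
Qed.

Variable th : 'cV[R]_n.
Variable A : forall t, {set {ffun 'I_n -> 'I_(2 * t).+1}}.
(** The inequality forces [2^-1 ^+ tau j] to decay exponentially in [t], faster than [enlargement]
    grows. *)
Hypothesis A_good : forall t tau, tau \in A t -> exists2 j, good j &
  (forall k, (tau k <= tau j)%N) /\ (t <= n * tau j + n)%N.

(** The first 2 comes from subtracting two solutions, the rest from replacing [phi v] by [phi u]
    with [|q'| <= 2 * 2 ^ t]. *)
Let K : R := 2 + 2 * C * step.+1%:R.

Lemma enlargement_le t : ((enlargement t)%:R : R) <= 2 ^+ n.+2 * t.+1%:R ^+ n.+2.
Proof.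
rewrite -exprMn -natrM -natrX ler_nat /enlargement.
rewrite -[n.+2]addn2 expnD leq_mul//.
  have [n0|n0] := posnP n; first by rewrite n0.
  by rewrite leq_exp2r//; lia.
by rewrite expnS expn1; apply: leq_mul; lia.
Qed.

Let limsup_aux : exists T0 : nat, forall t, (T0 <= t)%N -> forall tau, tau \in A t ->
  exists E, [/\ measurable E,
     [set x | [set u | [/\ cube a l u, bad th tau (phi u) & ~ bad_hom K tau (phi u)]]
        (row_of_tuple x)] `<=` E &
     (lebesgue_tuple d E <= ((4 * l) ^+ d / (enlargement t)%:R)%:E)%E].
Proof.
(* [T1] serves [s_small], with a power [n] because only [t <= n * tau j + n] is known; [T2] makes
   [M * step] cells fit into the cube. *)
have [T1 h1] := poly_lt_exp2 ((4 * C * step.+1%:R * 2 ^+ n.+2) ^+ n * 2 ^+ n) (n.+2 * n).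
have [T2 h2] := poly_lt_exp2 (step%:R * 2 ^+ n.+2 / l) n.+2.
exists (maxn (maxn T1 T2) 1) => t; rewrite !geq_max -andbA => /and3P[/h1 {}h1 /h2 {}h2 t0] tau tauA.
have [j gj [tmax tn]] := A_good tauA.
have [i hi] := phi_tame.2 j gj.
have n0 : (0 < n)%N by apply: leq_trans (ltn_ord j).
pose M := enlargement t.
have M0 : (0 < M)%N by rewrite /M /enlargement !muln_gt0 expn_gt0.
have M1 : 1 <= M%:R :> R by rewrite ler1n.
pose s : R := 2^-1 ^+ tau j.
have s0 : 0 < s by rewrite exprn_gt0// invr_gt0.
have s1 : s <= 1 by rewrite exprn_ile1// invf_le1// ler1n.
have sj k : s <= 2^-1 ^+ tau k.
  by apply: ler_wiXn2l => //; rewrite ?invr_ge0// invf_le1// ler1n.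
pose p2 : R := 2 ^+ t.
have p20 : 0 < p2 by rewrite exprn_gt0.
(* Up to constants, the width in the chart of a box of side [s] when [q] has size [2 ^ t]. *)
pose r := s / p2.
have r0 : 0 < r by rewrite divr_gt0.
have rp : p2 * r = s by rewrite mulrC divfK// gt_eqF.
have s_small : 4 * C * step.+1%:R * M%:R * s < 1.
  rewrite /s exprVn ltr_pdivrMr ?exprn_gt0// mul1r.
  rewrite -(ltr_pXn2r n0) ?nnegrE ?exprn_ge0 ?mulr_ge0//.
  rewrite -(@ltr_pM2r _ (2 ^+ n)) ?exprn_gt0// -exprM -exprD.
  apply: (@lt_le_trans _ _ (2 ^+ t)); last by rewrite ler_weXn2l ?ler1n// mulnC.
  apply: le_lt_trans h1; rewrite -[leRHS]mulrA [X in _ <= _ * X]mulrC mulrA ler_pM2r ?exprn_gt0//.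
  have e4 : 0 <= 4 * C * step.+1%:R by rewrite !mulr_ge0.
  have e2 : 0 <= (2 : R) ^+ n.+2 by rewrite exprn_ge0.
  have e3 : 0 <= (t.+1%:R : R) ^+ n.+2 by rewrite exprn_ge0.
  rewrite exprM -exprMn; apply: lerXn2r; rewrite ?nnegrE.
  - exact: mulr_ge0.
  - by apply: mulr_ge0 => //; exact: mulr_ge0.
  - by rewrite -[leRHS]mulrA ler_wpM2l//; exact: enlargement_le.
have Ml : (M * step)%:R * r <= l.
  rewrite /r mulrA ler_pdivrMr// natrM.
  apply: (@le_trans _ _ (M%:R * step%:R)); first by rewrite ler_piMr// mulr_ge0.
  rewrite mulrC [leRHS]mulrC -ler_pdivrMr// ltW//; apply: le_lt_trans h2.
  rewrite [leRHS]mulrAC ler_pM2r ?invr_gt0// -[leRHS]mulrA; apply: ler_wpM2l => //.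
  exact: enlargement_le.
have [||L [L1 L2 L3]] := @tile r M r0; [by []|by []|].
pose S := [set u | [/\ cube a l u, bad th tau (phi u) & ~ bad_hom K tau (phi u)]].
have [||E [E1 E2 E3]] := @grid_cover _ d S a r L M step i r0 M0 L1.
- by move=> u [Du _ _]; exact: L2.
(* Two bad points of the same column have the same q, since otherwise q - q'
   would be a homogeneous solution; then the expansion of phi_j along the i-th
   axis forces them to be close. *)
- move=> u v [Du [q [/andP[q1 q2] qu]] nh] [Dv [q' [/andP[q'1 q'2] qv]] _] uv uvi.
  pose e := (M * step).+1%:R * r.
  have re : r <= e by rewrite /e ler_peMl ?(ltW r0)// ler1n.
  have e0 : 0 <= e by rewrite (le_trans (ltW r0)).
  have uve k : `|u 0 k - v 0 k| <= e.
    by have [->//|ki] := eqVneq k i; rewrite (le_trans (uv _ ki)).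
  have eM : p2 * e <= step.+1%:R * M%:R * s.
    rewrite /e mulrCA rp ler_pM2r// -natrM ler_nat.
    by move: M0; clear; nia.
  have q'R : `|q'%:~R : R| <= 2 * p2.
    by rewrite norm_intr /p2 -exprS -natrX ler_nat ltnW.
  have lip k : `|q'%:~R * (phi u 0 k - phi v 0 k)| <= 2 * C * step.+1%:R * M%:R * s.
    rewrite normrM; apply: (@le_trans _ _ (2 * p2 * (C * e))).
      by apply: ler_pM => //; exact: (phi_tame.1 u v k e).
    rewrite (_ : 2 * p2 * _ = 2 * C * (p2 * e)); last by ring.
    rewrite (_ : 2 * C * _ * _ * s = 2 * C * (step.+1%:R * M%:R * s)); last by ring.
    by rewrite ler_wpM2l// mulr_ge0.
  have dif k : nint (q%:~R * phi u 0 k - q'%:~R * phi v 0 k) < 2 * 2^-1 ^+ tau k.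
    rewrite (_ : _ - _ = (q%:~R * phi u 0 k + th k 0) - (q'%:~R * phi v 0 k + th k 0)); last by ring.
    by apply: (le_lt_trans (nintB _ _)); have := qu k; have := qv k; lra.
  have qq' : q = q'.
    apply: contrapT => /eqP ne; apply: nh; exists (q - q'); split.
    - by rewrite subr_eq0.
    - by move: q2 q'2; rewrite !expnS; clear; lia.
    - move=> k; rewrite intrB.
      rewrite (_ : _ * _ = (q%:~R * phi u 0 k - q'%:~R * phi v 0 k)
        - q'%:~R * (phi u 0 k - phi v 0 k)); last by ring.
      apply: (le_lt_trans (nintB _ _)).
      have h3 := le_trans (nint_le_norm _) (lip k).
      have h4 := dif k; have h5 := sj k.
      have h6 : 2 * C * step.+1%:R * M%:R * s <= 2 * C * step.+1%:R * M%:R * 2^-1 ^+ tau k.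
        by rewrite ler_wpM2l// !mulr_ge0.
      have h7 : (2 : R) * 2^-1 ^+ tau k <= 2 * M%:R * 2^-1 ^+ tau k.
        rewrite ler_pM2r; last by rewrite exprn_gt0// invr_gt0.
        by lra.
      rewrite /K -/M; set X := 2^-1 ^+ tau k in h4 h5 h6 h7 *.
      rewrite (_ : _ * X = 2 * M%:R * X + 2 * C * step.+1%:R * M%:R * X); last by ring.
      by lra.
  (* By [s_small] the displacement of [q * phi_j] is below 1/2, so its distance to the nearest
     integer is its absolute value. *)
  have h3 := dif j; rewrite qq' -mulrBr nint_small in h3; last first.
    by have := lip j; rewrite -/s in s_small *; lra.
  have h4 : `|phi u 0 j - phi v 0 j| < 2 * r.
    rewrite -(ltr_pM2l p20) mulrCA rp; apply: le_lt_trans h3.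
    rewrite normrM ler_wpM2r// norm_intr /p2 -natrX ler_nat -qq'.
    exact: q1.
  apply: le_lt_trans (stepP r0); rewrite ler_pdivlMr// mulrC.
  apply: (le_trans (hi u v r Du Dv (ltW r0) uv)).
  by rewrite mulrDl; lra.
exists E; split=> //; apply: (le_trans E3).
by rewrite lee_fin ler_pM2r// invr_gt0 ltr0n.
Qed.

Lemma bad_limsup_null : exists2 K' : R, 0 <= K' & null [set u | [/\ cube a l u,
  forall T : nat, exists2 t, (T <= t)%N & exists2 tau, tau \in A t & bad th tau (phi u) &
  exists T : nat, forall t, (T <= t)%N -> forall tau, tau \in A t -> ~ bad_hom K' tau (phi u)]].
Proof.
exists K; first by rewrite addr_ge0// !mulr_ge0.
have [T0 hT0] := limsup_aux.
pose S t := [set u | cube a l u /\ exists2 tau, tau \in A t &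
  bad th tau (phi u) /\ ~ bad_hom K tau (phi u)].
(* The threshold in the third clause depends on [u], which a limsup tolerates. *)
apply: (@null_sub _ _ _ [set u | forall T : nat, exists2 t, (T <= t)%N & S t u]).
  move=> u [Du h [T' h']] T; have [t tT [tau tauA b]] := h (maxn T T').
  move: tT; rewrite geq_max => /andP[Tt T't].
  by exists t => //; split=> //; exists tau => //; split=> //; exact: h'.
apply: (@null_limsup _ _ S ((4 * l) ^+ d) T0).
  by rewrite exprn_ge0// mulr_ge0// ltW.
move=> t Tt.
have E_ex tau : exists E, tau \in A t -> [/\ measurable E,
     [set x | [set u | [/\ cube a l u, bad th tau (phi u) & ~ bad_hom K tau (phi u)]]
        (row_of_tuple x)] `<=` E &
     (lebesgue_tuple d E <= ((4 * l) ^+ d / (enlargement t)%:R)%:E)%E].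
  have [tauA|nA] := boolP (tau \in A t); last by exists set0.
  by have [E hE] := hT0 t Tt tau tauA; exists E.
have [E hE] := choice E_ex.
have [|mE leE] := @measure_bigU_le _ _ _ (lebesgue_tuple d) _ (enum (A t)) E
  ((4 * l) ^+ d / (enlargement t)%:R).
  by move=> tau; rewrite mem_enum => /hE[].
exists (\big[setU/set0]_(tau <- enum (A t)) E tau); split=> //.
  move=> x /= [Du [tau tauA [b nb]]]; rewrite -bigcup_seq; exists tau.
    by rewrite /= mem_enum.
  by have [_ + _] := hE _ tauA; apply.
apply: (le_trans leE); rewrite lee_fin -cardE mulrA ler_pdivrMr; last first.
  by rewrite ltr0n !muln_gt0 expn_gt0.
rewrite mulrAC ler_pdivlMr ?ltr0n// mulrAC [leRHS]mulrC -natrM.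
have B0 : 0 <= (4 * l) ^+ d by rewrite exprn_ge0// mulr_ge0// ltW.
rewrite [leLHS](_ : _ = (#|A t| * (t.+1 * t.+2))%:R * (4 * l) ^+ d); last first.
  by rewrite !natrM; ring.
rewrite ler_wpM2r// ler_nat /enlargement leq_mul2r.
by rewrite (leq_trans (max_card _)) ?orbT// card_ffun !card_ord.
Qed.

End local_transference.

(** * Local geometry of parametrizations *)

Section strict_differentiability.
Context {R : realType} {d n : nat}.
Implicit Types (phi : 'rV[R]_d -> 'rV[R]_n) (U : set 'rV[R]_d).

Lemma normr_mulmx_le m p (w : 'rV[R]_m) (B : 'M[R]_(m, p)) :
  `|w *m B| <= m%:R * (`|w| * `|B|).
Proof.
apply/normr_mx_leP => [|i j]; first by rewrite mulr_ge0// mulr_ge0.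
rewrite mxE (le_trans (ler_norm_sum _ _ _))//.
apply: (@le_trans _ _ (\sum_(k < m) `|w| * `|B|)).
  by apply: ler_sum => k _; rewrite normrM ler_pM// le_normr_mx.
by rewrite sumr_const card_ord -[leLHS]mulr_natl.
Qed.

Lemma mulmx_coordB m p (w : 'rV[R]_m) (B C : 'M[R]_(m, p)) j :
  (w *m C) 0 j - (w *m B) 0 j = - (w *m (B - C)) 0 j.
Proof. by rewrite mulmxBr [in RHS]mxE [X in - (_ + X)]mxE opprB. Qed.

Lemma mul_delta_coord m p (B : 'M[R]_(m, p)) i j :
  ((delta_mx 0 i : 'rV[R]_m) *m B) 0 j = B i j.
Proof. by rewrite -rowE mxE. Qed.

Lemma is_derive_line phi v w (s : R) j : differentiable phi (v + s *: w) ->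
  is_derive s 1 (fun s => phi (v + s *: w) 0 j) ((w *m 'J phi (v + s *: w)) 0 j).
Proof.
move=> df; set xi := v + s *: w in df *.
have dw : (fun h => h^-1 *: ((phi \o shift xi) (h *: w) - phi xi)) @ 0^' -->
    w *m 'J phi xi.
  by rewrite -deriveEjacobian//; exact: diff_derivable.
have H : (fun h => h^-1 *: (((fun s => phi (v + s *: w) 0 j) \o shift s) (h *: 1)
    - phi xi 0 j)) @ 0^' --> (w *m 'J phi xi) 0 j.
  rewrite (_ : (fun h : R => _) = (fun N : 'rV[R]_n => N 0 j) \o
      (fun h => h^-1 *: ((phi \o shift xi) (h *: w) - phi xi))).
    exact: cvg_comp dw (@coord_continuous R 1 n 0 j (w *m 'J phi xi)).
  apply/funext => h /=.
  rewrite !mxE [h%:A]mulr1 /xi; congr (_ * (phi _ 0 j - _)).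
  by rewrite scalerDl addrCA.
by split; [exact: cvgP H|exact: cvg_lim H].
Qed.

(** Strict differentiability, by the mean value theorem along the segment for each coordinate. *)
Lemma C1_strict U phi u0 (eta : R) : open U -> C1_on U phi -> U u0 -> 0 < eta ->
  exists2 r : R, 0 < r & forall u, `|u - u0| < r -> U u /\
    forall v, `|v - u0| < r ->
    forall j, `|phi u 0 j - phi v 0 j - ((u - v) *m 'J phi u0) 0 j| <= eta * `|u - v|.
Proof.
move=> oU hC Uu0 eta0.
have [_ Jc] := hC u0 Uu0.
(* Cancels the factor [d] of [normr_mulmx_le]; [d.+1] covers [d = 0]. *)
pose e := eta / d.+1%:R.
have e0 : 0 < e by rewrite divr_gt0.
have : nbhs u0 (U `&` [set v | `|'J phi u0 - 'J phi v| < e]).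
  apply: filterI; first exact: open_nbhs_nbhs.
  by move/cvgrPdist_lt : Jc; apply.
move=> /nbhs_normP[r /= r0 hr].
have {}hr u : `|u - u0| < r -> U u /\ `|'J phi u0 - 'J phi u| < e.
  by rewrite distrC => /hr.
exists r => // u ur; split; first by have [] := hr u ur.
move=> v vr j.
pose w := u - v; pose g (s : R) := phi (v + s *: w) 0 j.
have seg (s : R) : 0 <= s -> s <= 1 -> `|v + s *: w - u0| < r.
  move=> s0 s1; have -> : v + s *: w - u0 = (1 - s) *: (v - u0) + s *: (u - u0).
    rewrite /w !scalerBr scalerBl !scale1r.
    rewrite scalerBl scale1r; apply/matrixP => a b; rewrite !mxE; ring.
  apply: le_lt_trans (ler_normD _ _) _; rewrite !normrZ ger0_norm ?subr_ge0// ger0_norm//.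
  move: (`|v - u0|) (`|u - u0|) vr ur => p q pr qr.
  have [->|sn0] := eqVneq s 0; first by rewrite subr0 mul1r mul0r addr0.
  have sp : 0 < s by rewrite lt_neqAle eq_sym sn0.
  have h1 : (1 - s) * p <= (1 - s) * r by rewrite ler_wpM2l ?subr_ge0// ltW.
  have h2 : s * q < s * r by rewrite ltr_pM2l.
  by lra.
have dg (s : R) : 0 <= s -> s <= 1 -> is_derive s 1 g ((w *m 'J phi (v + s *: w)) 0 j).
  move=> s0 s1; apply: is_derive_line.
  by have [/hC[]] := hr _ (seg s s0 s1).
have [||c] := @MVT R g (fun s => (w *m 'J phi (v + s *: w)) 0 j) 0 1 ltr01.
- by move=> s; rewrite in_itv/= => /andP[s0 s1]; apply: dg; exact: ltW.
- apply: derivable_within_continuous => s; rewrite in_itv/= => /andP[s0 s1].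
  by have [] := dg s s0 s1.
rewrite in_itv/= => /andP[c0 c1]; rewrite subr0 mulr1 /g scale1r scale0r addr0.
have -> : v + w = u by rewrite /w addrC subrK.
rewrite -/w => ->.
rewrite mulmx_coordB normrN (le_trans (le_normr_mx _ _ _))// (le_trans (normr_mulmx_le _ _))//.
have [_ /ltW h] := hr _ (seg c (ltW c0) (ltW c1)).
apply: (@le_trans _ _ (d%:R * (`|w| * e))).
  by rewrite ler_wpM2l// ler_wpM2l.
rewrite mulrCA mulrC ler_wpM2r// /e mulrA ler_pdivrMr//.
by rewrite mulrC ler_wpM2l ?ler_nat// ltW.
Qed.

Lemma C1_tame U phi u0 : open U -> C1_on U phi -> U u0 ->
  exists r c C : R, [/\ 0 < r, 0 < c, 0 <= C &
    tame phi [set j | exists i, 'J phi u0 i j != 0] [set u | `|u - u0| < r] c C].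
Proof.
move=> oU hC Uu0; set A := 'J phi u0.
(* As [0^-1 = 0], zero entries contribute nothing, and [s^-1] bounds all nonzero entries from below
   at once. *)
pose s := 1 + \sum_i \sum_j `|A i j|^-1.
have s_ge i j : `|A i j|^-1 <= s.
  have h1 : `|A i j|^-1 <= \sum_j `|A i j|^-1.
    by rewrite (bigD1 j)//= lerDl sumr_ge0// => k _; rewrite invr_ge0.
  have h2 : \sum_j `|A i j|^-1 <= \sum_i \sum_j `|A i j|^-1.
    rewrite (bigD1 i)//= lerDl sumr_ge0// => k _.
    by rewrite sumr_ge0// => m _; rewrite invr_ge0.
  by rewrite /s; lra.
have s1 : 1 <= s.
  by rewrite lerDl sumr_ge0// => i _; rewrite sumr_ge0// => j _; rewrite invr_ge0.
have s0 : 0 < s by lra.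
pose c0 := s^-1.
have c00 : 0 < c0 by rewrite invr_gt0.
have Ac0 i j : A i j != 0 -> c0 <= `|A i j|.
  move=> Aij; rewrite -[leRHS]invrK lef_pV2 ?posrE ?invr_gt0 ?normr_gt0//.
(* With a remainder of rate [c0 / 2], half of the slope [c0] survives in the good direction. *)
have [|r r0 hr] := @C1_strict U phi u0 (c0 / 2) oU hC Uu0; first by rewrite divr_gt0.
have main u v j : `|u - u0| < r -> `|v - u0| < r ->
    `|phi u 0 j - phi v 0 j - ((u - v) *m A) 0 j| <= c0 / 2 * `|u - v|.
  by move=> /hr[_ h] /h.
clear hr; clearbody A.
exists r, (c0 / 2), (d%:R * `|A| + c0 / 2); split=> //.
- by rewrite divr_gt0.
- by apply: addr_ge0; [exact: mulr_ge0|apply: divr_ge0 => //; exact: ltW].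
split.
  move=> u v j e /= ur vr e0 uv.
  have h1 : `|u - v| <= e.
    by apply/normr_mx_leP => // i k; rewrite ord1 !mxE.
  have h2 := main u v j ur vr.
  have h3 : `|((u - v) *m A) 0 j| <= d%:R * (e * `|A|).
    rewrite (le_trans (le_normr_mx _ _ _))// (le_trans (normr_mulmx_le _ _))//.
    by rewrite ler_wpM2l// ler_wpM2r.
  have h4 : c0 / 2 * `|u - v| <= c0 / 2 * e by rewrite ler_wpM2l// divr_ge0// ltW.
  have := ler_normD (phi u 0 j - phi v 0 j - ((u - v) *m A) 0 j) (((u - v) *m A) 0 j).
  by rewrite subrK => h5; rewrite mulrDl -mulrA [`|A| * e]mulrC; lra.
move=> j [i Aij]; exists i => u v e /= ur vr e0 uv.
have h2 := main u v j ur vr.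
pose w := u - v.
have wE k : w 0 k = u 0 k - v 0 k by rewrite !mxE.
have h1 : `|w| <= `|w 0 i| + e.
  apply/normr_mx_leP => [|a k]; first by rewrite addr_ge0.
  rewrite ord1; have [->|ki] := eqVneq k i; first by rewrite lerDl.
  by rewrite (le_trans (_ : _ <= e)) ?lerDr// wE; exact: uv.
have h3 : `|(w *m A) 0 j - w 0 i * A i j| <= d%:R * (e * `|A|).
  rewrite mxE (bigD1 i)//= addrAC subrr add0r (le_trans (ler_norm_sum _ _ _))//.
  apply: (@le_trans _ _ (\sum_(k < d) e * `|A|)).
    rewrite [leRHS](bigD1 i)//= -[leLHS]add0r lerD// ?mulr_ge0//.
    by apply: ler_sum => k ki; rewrite normrM ler_pM// ?le_normr_mx// wE; exact: uv.
  by rewrite sumr_const card_ord -[leLHS]mulr_natl.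
have h4 : c0 / 2 * `|w| <= c0 / 2 * (`|w 0 i| + e) by rewrite ler_wpM2l// divr_ge0// ltW.
have h5 : c0 * `|w 0 i| <= `|w 0 i * A i j|.
  by rewrite normrM mulrC ler_wpM2l// Ac0.
rewrite -/w in h2; rewrite -wE.
have h6 := ler_normD (phi u 0 j - phi v 0 j) (- (phi u 0 j - phi v 0 j - (w *m A) 0 j)).
have h7 := ler_normB (phi u 0 j - phi v 0 j + - (phi u 0 j - phi v 0 j - (w *m A) 0 j)) ((w *m A) 0 j - w 0 i * A i j).
rewrite normrN in h6.
have e7 : phi u 0 j - phi v 0 j + - (phi u 0 j - phi v 0 j - (w *m A) 0 j) - ((w *m A) 0 j - w 0 i * A i j) = w 0 i * A i j.
  by ring.
rewrite e7 in h7.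
rewrite (_ : (_ + _) * e = d%:R * (e * `|A|) + c0 / 2 * e); last by ring.
by clear -h2 h3 h4 h5 h6 h7; lra.
Qed.

Lemma diff_jacobian phi u h : differentiable phi u -> 'd phi u h = h *m 'J phi u.
Proof. by move=> df; rewrite -deriveEjacobian// deriveE. Qed.

(** Injectivity makes the Jacobian row free, so [pinvmx] is a right inverse, whose norm yields
    [k]. *)
Lemma inj_diff_lower phi u : differentiable phi u -> injective ('d phi u) ->
  exists2 k : R, 0 < k & forall w : 'rV[R]_d, k * `|w| <= `|w *m 'J phi u|.
Proof.
move=> df inj.
have fr : row_free ('J phi u).
  apply: inj_row_free => v; rewrite -diff_jacobian// => h.
  by apply: inj; rewrite h linear0.
pose P := pinvmx ('J phi u).
have k0 : 0 < n%:R * `|P| + 1 by rewrite ltr_wpDl// mulr_ge0.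
exists (n%:R * `|P| + 1)^-1; first by rewrite invr_gt0.
move=> w; rewrite mulrC ler_pdivrMr//.
have {1}-> : w = w *m 'J phi u *m P by rewrite -mulmxA mulmxVp// mulmx1.
rewrite (le_trans (normr_mulmx_le _ _))// mulrCA ler_wpM2l//.
by rewrite lerDl.
Qed.

End strict_differentiability.

(* If the i-th coordinate of 'd phi u vanishes, then the i-th coordinate is
   o(distance) along M at phi u, hence along any other parametrization. *)
Lemma tangent_coord_eq0 (R : realType) (d n : nat) (M : set 'rV[R]_n)
    (U V : set 'rV[R]_d) (phi psi : 'rV[R]_d -> 'rV[R]_n) u u' (j : 'I_n) :
  local_parametrization M U phi -> local_parametrization M V psi ->
  U u -> V u' -> psi u' = phi u ->
  (forall i, 'J phi u i j = 0) -> forall i, 'J psi u' i j = 0.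
Proof.
move=> [oU [phiC phiI] _ phiM] [oV [psiC _] _ psiM] Uu Vu' xE J0 i.
have [dphi _] := phiC u Uu; have [dpsi _] := psiC u' Vu'.
apply: contrapT => /eqP; set b := 'J psi u' i j => b0.
have [k k0 hk] := inj_diff_lower dphi (phiI u Uu).
set B := 'J psi u' in b b0 *; set A := 'J phi u in hk J0 *.
pose h : 'rV[R]_d := delta_mx 0 i.
have hB : (h *m B) 0 j = b by exact: mul_delta_coord.
pose C := d%:R * (`|h| * `|B|).
have C0 : 0 <= C by rewrite mulr_ge0// mulr_ge0.
have b1 : 0 < `|b| by rewrite normr_gt0.
have h0 : 0 <= `|h| by [].
(* Contradiction aimed at: a step [t *: h] changes [psi_j] by at least [t * |b| - t * |b| / 4] by
   the choice of [e1], while [e2] keeps the change of [phi_j] at most [t * |b| / 2]. *)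
pose e1 := `|b| / (4 * (`|h| + 1)).
have e10 : 0 < e1 by rewrite divr_gt0// mulr_gt0// ltr_wpDl.
have e1h : e1 * `|h| <= `|b| / 4.
  rewrite /e1 mulrAC ler_pdivrMr ?mulr_gt0 ?ltr_wpDl//.
  by rewrite -mulrA [4^-1 * _]mulrA mulVf// mul1r; nra.
pose e2 := Num.min (k / 2) (k * `|b| / (4 * (C + `|b|))).
have Cb : 0 < C + `|b| by lra.
have e20 : 0 < e2 by rewrite lt_min !divr_gt0//= ?mulr_gt0.
have e2k : e2 <= k / 2 by rewrite ge_min lexx.
have e2b : e2 * (4 * (C + `|b|)) <= k * `|b|.
  by rewrite -ler_pdivlMr ?mulr_gt0// ge_min lexx orbT.
have [r r0 hr] := C1_strict oU phiC Uu e20.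
have [s s0 hs] := C1_strict oV psiC Vu' e10.
rewrite -/A in hr; rewrite -/B in hs; clearbody A B.
have oW : open [set v | `|v - u| < r].
  rewrite (_ : [set v | _] = ball u r); first exact: ball_open.
  by apply/seteqP; split=> v; rewrite -ball_normE /= distrC.
(* [phi] is open onto its image in [M]: points of [M] close to [phi u], such as [psi z] below, are
   of the form [phi v] with [v] close to [u]. *)
have [V0 oV0 V0E] := phiM _ oW (fun v vr => (hr v vr).1).
have V0x : V0 (phi u).
  have [_] : (M `&` V0) (phi u).
    by rewrite -V0E; exists u => //=; rewrite subrr normr0.
  by [].
have [V1 _ V1E] := psiM _ oV (@subset_refl _ V).
have : nbhs u' [set v | V0 (psi v)].
  apply: (differentiable_continuous dpsi); rewrite xE.
  exact: open_nbhs_nbhs.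
move=> /nbhs_normP[s' /= s'0 hs'].
pose t := Num.min s s' / (2 * (`|h| + 1)).
have m0 : 0 < Num.min s s' by rewrite lt_min s0.
have t0 : 0 < t by rewrite divr_gt0 ?mulr_gt0 ?ltr_wpDl.
have th : `|t *: h| < Num.min s s'.
  rewrite normrZ gtr0_norm// /t mulrAC ltr_pdivrMr ?mulr_gt0 ?ltr_wpDl//.
  by rewrite ltr_pM2l//; lra.
clearbody t.
pose z := u' + t *: h.
have zu : z - u' = t *: h by rewrite /z addrC addKr.
have [Vz hz] := hs z ltac:(by rewrite zu (lt_le_trans th)// ge_min lexx).
have Mz : (M `&` V0) (psi z).
  split; last first.
    by apply: hs'; rewrite /= -normrN opprB zu (lt_le_trans th)// ge_min lexx orbT.
  by have [] : (M `&` V1) (psi z) by rewrite -V1E; exists z.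
move: Mz; rewrite -V0E => -[v /= vr vz].
have [_ hv] := hr v vr.
have uu : `|u - u| < r by rewrite subrr normr0.
have uu' : `|u' - u'| < s by rewrite subrr normr0.
have pj := hz u' uu'.
rewrite zu in pj.
have vj := hv u uu j.
have J0j : ((v - u) *m A) 0 j = 0.
  by rewrite mxE big1// => l _; rewrite J0 mulr0.
rewrite J0j subr0 vz -xE in vj.
have lowv : k / 2 * `|v - u| <= `|phi v - phi u|.
  have h1 : `|(v - u) *m A| <= `|phi v - phi u| + e2 * `|v - u|.
    apply/normr_mx_leP; first by rewrite addr_ge0// mulr_ge0// ltW.
    move=> a l; rewrite ord1.
    have h2 := hv u uu l.
    have h3 := ler_normB (phi v 0 l - phi u 0 l) (phi v 0 l - phi u 0 l - ((v - u) *m A) 0 l).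
    rewrite subKr in h3.
    have := le_normr_mx (phi v - phi u) 0 l; rewrite !mxE.
    by rewrite !mxE in h2 h3; lra.
  have h4 := hk (v - u).
  have h5 : e2 * `|v - u| <= k / 2 * `|v - u| by rewrite ler_wpM2r.
  by lra.
have upz : `|psi z - psi u'| <= t * (C + `|b|).
  apply/normr_mx_leP; first by rewrite mulr_ge0 ?ltW.
  move=> a l; rewrite ord1.
  have h1 := pj l.
  have h2 : `|((t *: h) *m B) 0 l| <= t * C.
    rewrite -scalemxAl mxE normrM gtr0_norm// ler_pM2l//.
    by rewrite (le_trans (le_normr_mx _ _ _))// normr_mulmx_le.
  have h3 : e1 * `|t *: h| <= t * `|b|.
    rewrite normrZ gtr0_norm// mulrCA ler_wpM2l ?(ltW t0)//; lra.
  have := ler_normD (psi z 0 l - psi u' 0 l - ((t *: h) *m B) 0 l) (((t *: h) *m B) 0 l).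
  by rewrite subrK !mxE in h1 h2 *; lra.
have := pj j; rewrite -scalemxAl mxE hB normrZ gtr0_norm// => pj'.
have q1 : t * `|b| <= `|psi z 0 j - psi u' 0 j| + e1 * (t * `|h|).
  have := ler_normB (psi z 0 j - psi u' 0 j) (psi z 0 j - psi u' 0 j - t * b).
  by rewrite subKr normrM gtr0_norm//; lra.
have q2 : `|v - u| <= 2 / k * (t * (C + `|b|)).
  rewrite [leRHS]mulrAC ler_pdivlMr//.
  rewrite vz -xE in lowv; lra.
have q3 : e2 * `|v - u| <= t * `|b| / 2.
  apply: (@le_trans _ _ (e2 * (2 / k * (t * (C + `|b|))))); first by rewrite ler_wpM2l// ltW.
  rewrite (_ : _ * _ = t / (2 * k) * (e2 * (4 * (C + `|b|)))); last by field; rewrite gt_eqF.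
  apply: (@le_trans _ _ (t / (2 * k) * (k * `|b|))); first by rewrite ler_wpM2l// divr_ge0 ?mulr_ge0 ?ltW.
  by rewrite le_eqVlt; apply/orP; left; apply/eqP; field; rewrite gt_eqF.
have q4 : e1 * (t * `|h|) <= t * `|b| / 4.
  by rewrite mulrCA -mulrA ler_wpM2l// ltW.
have tb : 0 < t * `|b| by rewrite mulr_gt0.
suff : t * `|b| < t * `|b| by rewrite ltxx.
lra.
Qed.

(** * Riemannian measure zero *)

Section rational_cubes.
Context {R : realType} {d : nat}.

Definition rat_cube (p : 'rV[rat]_d * nat) : set 'rV[R]_d :=
  cube (map_mx ratr p.1) p.2.+1%:R^-1.

Lemma rat_cube_nbhs (u : 'rV[R]_d) (r : R) : 0 < r ->
  exists p, rat_cube p u /\ rat_cube p `<=` [set v | `|v - u| < r].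
Proof.
move=> r0; pose k := Num.truncn r^-1.
have k0 : (0 : R) < k.+1%:R^-1 by rewrite invr_gt0.
have kr : k.+1%:R^-1 < r.
  by rewrite -[ltRHS]invrK ltf_pV2 ?posrE ?invr_gt0//; exact: truncnS_gt.
clearbody k.
have a_ex l : exists z : rat, ratr z \in `]u 0 l - k.+1%:R^-1, u 0 l[%R.
  by apply: rat_in_itvoo; rewrite ltrBlDr ltrDl.
have [a ha] := choice a_ex.
exists (\row_l a l, k); split=> [l|v hv] /=.
  have := ha l; rewrite in_itv/= !mxE => /andP[h1 h2].
  by move: h1; move: (k.+1%:R^-1) => e h1; apply/andP; split; lra.
apply/normr_mx_ltP => // i l; rewrite ord1 !mxE.
have := hv l; have := ha l; rewrite in_itv/= !mxE => /andP[h1 h2] /andP[h3 h4].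
move: kr h1 h4; move: (k.+1%:R^-1) => e *.
by rewrite ltr_norml; apply/andP; split; lra.
Qed.

Lemma rat_cube_tuple p : [set t | rat_cube p (row_of_tuple t)] =
  tuple_box (fun i => ratr (p.1 0 i)) p.2.+1%:R^-1.
Proof.
by apply/seteqP; split=> t h i; have := h i; rewrite !mxE.
Qed.

Lemma null_bigcup_count (T : countType) (F : T -> set 'rV[R]_d) :
  (forall i, null (F i)) -> null (\bigcup_i F i).
Proof.
move=> h; apply: (@null_sub _ _ _ (\bigcup_k (if unpickle k is Some i then F i else set0))).
  by move=> u [i _ Fu]; exists (pickle i); rewrite ?pickleK.
apply: null_bigcup => k; case: unpickle => [//|].
by exists set0; rewrite measure0; split=> // t.
Qed.

(** Lindelof argument with the countably many rational cubes; [S] may be any set. *)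
Lemma null_locally (S : set 'rV[R]_d) :
  (forall u, S u -> exists2 r : R, 0 < r & forall a l, 0 < l ->
     cube a l `<=` [set v | `|v - u| < r] -> null (S `&` cube a l)) -> null S.
Proof.
move=> h; pose good := [set p | null (S `&` rat_cube p)].
apply: (@null_sub _ _ _ (\bigcup_p (if `[< good p >] then S `&` rat_cube p else set0))).
  move=> u Su; have [r r0 hr] := h u Su.
  have [p [pu pr]] := rat_cube_nbhs u r0.
  exists p => //; rewrite ifT//; apply/asboolP; apply: hr => //.
apply: null_bigcup_count => p; case: asboolP => // _.
by exists set0; rewrite measure0; split=> // t.
Qed.

Lemma measurable_open_tuple (U : set 'rV[R]_d) : open U ->
  measurable ([set t | U (row_of_tuple t)] : set (d.-tuple (measurableTypeR R))).
Proof.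
move=> oU.
have -> : [set t | U (row_of_tuple t)] = \bigcup_p
    (if `[< rat_cube p `<=` U >] then [set t | rat_cube p (row_of_tuple t)] else set0).
  apply/seteqP; split=> t /=.
    move=> Ut; have : nbhs (row_of_tuple t) U by exact: open_nbhs_nbhs.
    move=> /nbhs_normP[r /= r0 hr].
    have [p [pu pr]] := rat_cube_nbhs (row_of_tuple t) r0.
    exists p => //; rewrite ifT//; apply/asboolP => v /pr /= vr.
    by apply: hr; rewrite /= distrC.
  by move=> [p _]; case: asboolP => // pU /= /pU.
apply: countable_bigcupT_measurable => // p; case: asboolP => // _.
by rewrite rat_cube_tuple; exact: measurable_tuple_box.
Qed.

End rational_cubes.

Section charts.
Context {R : realType} {d n : nat}.
Implicit Types (U : set 'rV[R]_d) (phi : 'rV[R]_d -> 'rV[R]_n).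

Lemma open_preimage (T : topologicalType) U (f : 'rV[R]_d -> T) (V : set T) :
  open U -> (forall u, U u -> {for u, continuous f}) -> open V ->
  open (U `&` f @^-1` V).
Proof.
move=> oU fc oV; rewrite openE => u [Uu Vfu].
apply: filterI; first exact: open_nbhs_nbhs.
by apply: fc => //; exact: open_nbhs_nbhs.
Qed.

Lemma measurable_chart U phi (B : set (borel_rV R n)) : open U ->
  (forall u, U u -> {for u, continuous phi}) -> measurable B ->
  measurable ([set t | U (row_of_tuple t) /\ B (phi (row_of_tuple t))] :
    set (d.-tuple (measurableTypeR R))).
Proof.
move=> oU phic mB.
have mf : measurable_fun ([set t | U (row_of_tuple t)] : set (d.-tuple (measurableTypeR R)))
    (fun t => phi (row_of_tuple t) : borel_rV R n).
  have h := @measurability _ _ (d.-tuple (measurableTypeR R)) (borel_rV R n)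
    [set t | U (row_of_tuple t)] (fun t => phi (row_of_tuple t)) (@open 'rV[R]_n) erefl.
  apply: h => // _ [V oV <-].
  exact: (measurable_open_tuple (open_preimage oU phic oV)).
exact: (mf (measurable_open_tuple oU) _ mB).
Qed.

Lemma measurable_real_chart U (f : 'rV[R]_d -> R) : open U ->
  (forall u, U u -> {for u, continuous f}) ->
  measurable_fun ([set t | U (row_of_tuple t)] : set (d.-tuple (measurableTypeR R)))
    (fun t => f (row_of_tuple t)).
Proof.
move=> oU fc; apply: (measurability _ (RGenOpens.measurableE R)) => //.
move=> _ [_ [a [b ->] <-]].
exact: (measurable_open_tuple (open_preimage oU fc (@interval_open _ _ _ _ _))).
Qed.

Lemma measurable_volume_density U phi : open U -> C1_on U phi ->
  measurable_fun ([set t | U (row_of_tuple t)] : set (d.-tuple (measurableTypeR R)))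
    (fun t => volume_density phi (row_of_tuple t)).
Proof.
move=> oU hC.
have mJ i j : measurable_fun ([set t | U (row_of_tuple t)] : set (d.-tuple (measurableTypeR R)))
    (fun t => 'J phi (row_of_tuple t) i j).
  apply: (@measurable_real_chart U (fun u => 'J phi u i j)) => // u Uu.
  have [_ Jc] := hC u Uu.
  exact: (continuous_comp Jc (@coord_continuous R d n i j _)).
have mG i i' : measurable_fun ([set t | U (row_of_tuple t)] : set (d.-tuple (measurableTypeR R)))
    (fun t => ('J phi (row_of_tuple t) *m ('J phi (row_of_tuple t))^T) i i').
  rewrite (_ : (fun t => _) = (fun t : d.-tuple R =>
      \sum_k 'J phi (row_of_tuple t) i k * 'J phi (row_of_tuple t) i' k)).
    by apply: measurable_sum => k; exact: measurable_funM.
  apply/funext => t; rewrite mxE; apply: eq_bigr => k _; congr (_ * _).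
  by rewrite mxE.
apply: measurableT_comp.
  apply: continuous_measurable_fun; exact: sqrt_continuous.
apply: measurable_sum => s; apply: measurable_funM; first exact: measurable_cst.
by apply: measurable_prod => i _; exact: mG.
Qed.

Lemma chart_volume_ge0 U phi (B : set 'rV[R]_n) : (0 <= chart_volume U phi B)%E.
Proof. by apply: integral_ge0 => t _; rewrite lee_fin sqrtr_ge0. Qed.

Lemma chart_volume_split M U phi (B N : set (borel_rV R n)) :
  local_parametrization M U phi -> measurable B -> measurable N ->
  chart_volume U phi B = (chart_volume U phi (B `&` N) + chart_volume U phi (B `\` N))%E.
Proof.
move=> [oU [phiC _] _ _] mB mN.
have phic u : U u -> {for u, continuous phi}.
  by move=> /phiC[/differentiable_continuous].
pose S (A : set (borel_rV R n)) := [set t : d.-tuple (measurableTypeR R) |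
  U (row_of_tuple t) /\ A (phi (row_of_tuple t))].
have SE : S B = S (B `&` N) `|` S (B `\` N).
  apply/seteqP; split=> t /=.
    by move=> [Ut Bt]; have [Nt|Nt] := pselect (N (phi (row_of_tuple t))); [left|right].
  by move=> [[Ut [Bt _]]|[Ut [Bt _]]].
rewrite /chart_volume -/(S _) -/(S (B `&` N)) -/(S (B `\` N)) [in LHS]SE.
apply: ge0_integral_setU.
- by apply: measurable_chart => //; exact: measurableI.
- by apply: measurable_chart => //; exact: measurableD.
- rewrite -SE; apply/measurable_EFinP.
  apply: (measurable_funS _ _ (measurable_volume_density oU phiC)).
  + exact: measurable_open_tuple.
  + by move=> t [].
- by move=> t _; rewrite lee_fin sqrtr_ge0.
- by apply/disj_setPS => t [[_ [_ Nt]] [_ [_ nNt]]].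
Qed.

Lemma chart_volume_null M U phi (B : set (borel_rV R n)) :
  local_parametrization M U phi -> measurable B ->
  null [set u | U u /\ B (phi u)] -> chart_volume U phi B = 0%E.
Proof.
move=> [oU [phiC _] _ _] mB [N [mN N0 SN]].
have phic u : U u -> {for u, continuous phi}.
  by move=> /phiC[/differentiable_continuous].
have mS := measurable_chart oU phic mB.
apply: null_set_integral => //.
- apply/measurable_EFinP.
  apply: (measurable_funS _ _ (measurable_volume_density oU phiC)).
  + exact: measurable_open_tuple.
  + by move=> t [].
- by apply: (subset_measure0 _ _ SN).
Qed.

(** All terms are nonnegative, so one-piece families detect nonvanishing; the empty family shows
    that the supremum is at least 0. *)
Lemma riemannian_measure_eq0 M (A : set (borel_rV R n)) :
  riemannian_measure d M A = 0%E <->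
  forall U phi (B : set (borel_rV R n)), local_parametrization M U phi ->
    measurable B -> B `<=` A `&` phi @` U -> chart_volume U phi B = 0%E.
Proof.
split=> [A0 U phi B Uphi mB BA|h].
  apply/eqP; rewrite eq_le chart_volume_ge0 andbT -A0.
  apply: ereal_sup_ubound; exists 1%N, (fun=> U), (fun=> phi), (fun=> B).
  split=> //; last by rewrite big_ord1.
  by move=> i j _ _ _; rewrite !ord1.
apply/eqP; rewrite eq_le; apply/andP; split.
  apply: ge_ereal_sup => _ [k [U [phi [B [hU hB _ ->]]]]].
  by rewrite big1// => i _; have [mB BA] := hB i; exact: (h _ _ _ (hU i)).
apply: ereal_sup_ubound; exists 0%N, (fun=> setT), (fun=> cst 0), (fun=> set0).
split=> //; by [case|case|rewrite big_ord0|move=> []].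
Qed.

(** Carries almost-everywhere hypotheses on [M] into charts without an atlas: each Borel piece is
    cut along [N1], then [N2], and only the remainder has to be null in the chart. *)
Lemma riemannian_measure_cover M (N1 N2 A : set (borel_rV R n)) :
  measurable N1 -> measurable N2 -> measurable A ->
  riemannian_measure d M N1 = 0%E -> riemannian_measure d M N2 = 0%E ->
  (forall U phi, local_parametrization M U phi ->
     null [set u | U u /\ (A `\` N1 `\` N2) (phi u)]) ->
  riemannian_measure d M A = 0%E.
Proof.
move=> m1 m2 mA /riemannian_measure_eq0 h1 /riemannian_measure_eq0 h2 hA.
apply/riemannian_measure_eq0 => U phi B Uphi mB BA.
rewrite (chart_volume_split Uphi mB m1) (h1 U phi)//; first last.
- by move=> x [Bx Nx]; split=> //; exact: (BA x Bx).2.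
- exact: measurableI.
have mD := measurableD mB m1.
rewrite add0e (chart_volume_split Uphi mD m2) (h2 U phi)//; first last.
- by move=> x [[Bx _] Nx]; split=> //; exact: (BA x Bx).2.
- exact: measurableI.
rewrite add0e; apply: (chart_volume_null Uphi); first exact: measurableD.
apply: null_sub (hA U phi Uphi) => u [Uu [[Bu n1] n2]]; split=> //; split=> //.
by split=> //; exact: (BA _ Bu).1.
Qed.

End charts.

(** * The exceptional set *)

Lemma lt_powR2 (R : realType) (x y : R) : x < y -> 2 `^ x < 2 `^ y.
Proof.
move=> xy; rewrite /powR !ifF ?pnatr_eq0// ltr_expR ltr_pM2r//.
by rewrite ln_gt0// ltr1n.
Qed.

Section error_functions.
Context {R : realType} {n : nat}.
Hypothesis n_gt0 : (0 < n)%N.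
Implicit Types (x : 'rV[R]_n) (th : 'cV[R]_n).

Definition err (mult : bool) x th : int -> R :=
  if mult then prod_err x th else sup_err x th.

Lemma err_le mult x th q (y : 'I_n -> R) :
  (forall j, nint (q%:~R * x 0 j + th j 0) <= y j) ->
  mult || [forall j, forall k, y j == y k] -> err mult x th q <= \prod_j y j.
Proof.
move=> hy; have [mt|mt] := boolP mult; rewrite /err => yc.
  by apply: ler_prod => j _; rewrite nint_ge0 hy.
rewrite /= in yc; have j0 := Ordinal n_gt0.
have yE j : y j = y j0 by apply/eqP; exact: (forallP (forallP yc j)).
rewrite (eq_bigr (fun=> y j0)); last by move=> j _; exact: yE.
rewrite prodr_const card_ord /sup_err lerXn2r ?nnegrE ?bigmax_ge_id//.
  exact: le_trans (nint_ge0 _) (hy j0).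
apply/bigmax_leP; split=> [|j _]; first exact: le_trans (nint_ge0 _) (hy j0).
by rewrite -(yE j).
Qed.

(** The sup norm gives a product as well, of [n] copies of the maximum; this is why it corresponds
    to constant profiles. *)
Lemma err_factor mult x th q : exists y : 'I_n -> R,
  [/\ forall j, nint (q%:~R * x 0 j + th j 0) <= y j <= 2^-1,
      mult || [forall j, forall k, y j == y k] & err mult x th q = \prod_j y j].
Proof.
rewrite /err; case: mult => /=.
  by exists (fun j => nint (q%:~R * x 0 j + th j 0)); split=> // j;
    rewrite lexx nint_le_half.
pose z := \big[Num.max/0]_(j < n) nint (q%:~R * x 0 j + th j 0).
exists (fun=> z); split.
- move=> j; apply/andP; split.
    exact: (le_bigmax _ (fun j => nint (q%:~R * x 0 j + th j 0))).
  by apply/bigmax_leP; split=> [|i _]; rewrite ?invr_ge0// nint_le_half.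
- by apply/forallP => j; apply/forallP => k.
- by rewrite prodr_const card_ord.
Qed.

Lemma err_ge0 mult x th q : 0 <= err mult x th q.
Proof.
have [y [hy _ ->]] := err_factor mult x th q.
by apply: prodr_ge0 => j _; have /andP[h _] := hy j; exact: le_trans (nint_ge0 _) h.
Qed.

Lemma err_eq0 mult x th q : err mult x th q = 0 ->
  if mult then exists j, nint (q%:~R * x 0 j + th j 0) = 0
  else forall j, nint (q%:~R * x 0 j + th j 0) = 0.
Proof.
rewrite /err; case: mult => /eqP.
  by rewrite prodf_seq_eq0 => /hasP[j _ /= /eqP h]; exists j.
rewrite expf_eq0 => /andP[_ /eqP h] j; apply/eqP; rewrite eq_le nint_ge0 andbT.
by rewrite -h; exact: (le_bigmax _ (fun j => nint (q%:~R * x 0 j + th j 0))).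
Qed.

(* With w = 1 + 1/(m+1), the condition on tau is w t <= \sum_j tau_j + n. The
   cap tau_j <= 2 t is harmless as w <= 2: one capped coordinate suffices for it. *)
Definition profiles (mult : bool) (m t : nat) : {set {ffun 'I_n -> 'I_(2 * t).+1}} :=
  [set tau : {ffun 'I_n -> 'I_(2 * t).+1} | (mult || [forall j, forall k, tau j == tau k]) &&
    (m.+2 * t <= m.+1 * (\sum_j (tau j : nat) + n))%N]%SET.

Lemma profile_exists mult m t x th (q : int) : (2 ^ t <= absz q < 2 ^ t.+1)%N ->
  err mult x th q <= (2 ^+ t) `^ (- (1 + m.+1%:R^-1)) ->
  exists2 tau, tau \in profiles mult m t & bad th tau x.
Proof.
move=> qt eq; have [y [hy yc yE]] := err_factor mult x th q.
(* [k] is the least exponent with [2^-(k+1) <= z], capped at [2 * t]; the cap also covers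
   [z = 0]. *)
have dyadic (z : R) : exists k : 'I_(2 * t).+1, z <= 2^-1 ->
    z < 2^-1 ^+ k /\ (k = (2 * t)%N :> nat \/ 2^-1 ^+ k.+1 <= z).
  have [zt|zt] := ltP z (2^-1 ^+ (2 * t)).
    by exists ord_max => _; split=> //; left.
  have ex : exists k, 2^-1 ^+ k.+1 <= z.
    by exists (2 * t)%N; rewrite exprS (le_trans _ zt)// ler_piMl ?exprn_ge0 ?invr_ge0// invf_le1// ler1n.
  have [k hk mk] := ex_minnP ex.
  have kt : (k < (2 * t).+1)%N.
    rewrite ltnS; apply: mk; rewrite exprS (le_trans _ zt)// ler_piMl ?exprn_ge0 ?invr_ge0//.
    by rewrite invf_le1// ler1n.
  exists (Ordinal kt) => z2 /=; split; last by right.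
  case: k hk mk kt => [|k] hk mk kt; first by rewrite expr0; lra.
  by rewrite ltNge; apply/negP => /mk; rewrite ltnn.
have [tf htf] := choice dyadic.
pose tau := [ffun j => tf (y j)].
have tauP j : y j < 2^-1 ^+ tau j /\ (tau j = (2 * t)%N :> nat \/ 2^-1 ^+ (tau j).+1 <= y j).
  by rewrite ffunE; apply: htf; have /andP[] := hy j.
exists tau; last first.
  exists q; split=> // j; have /andP[h _] := hy j; apply: le_lt_trans h _.
  by have [] := tauP j.
rewrite inE; apply/andP; split.
  move: yc; case: mult eq yE => //= _ _ yc.
  apply/forallP => j; apply/forallP => k; rewrite !ffunE.
  by rewrite (eqP (forallP (forallP yc j) k)).
have [/existsP[j /eqP jt]|/existsPn nt] := boolP [exists j, tau j == (2 * t)%N :> nat].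
  have : (tau j <= \sum_j tau j)%N by rewrite (bigD1 j)//= leq_addr.
  by rewrite {1}jt; move: (\sum_j tau j)%N => z hz; nia.
(* Each [tau_j] is sharp up to a factor 2; these [n] factors are the [+ n] in [profiles]. *)
have prod_low : 2^-1 ^+ (\sum_j tau j + n) <= err mult x th q.
  rewrite yE -[X in (_ + X)%N]card_ord -sum1_card -big_split /= -prodrXr.
  apply: ler_prod => j _; rewrite exprn_ge0 ?invr_ge0//= addn1.
  by have [_ [jt|//]] := tauP j; have := nt j; rewrite jt eqxx.
rewrite -(ler_nat R) natrM natrM.
have m0 : (0 : R) < m.+1%:R by [].
rewrite -ler_pdivrMl// mulrCA mulrA -[m.+2%:R]natr1 mulrDl mulfV ?gt_eqF// mul1r.
set w := 1 + _ in eq *.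
rewrite leNgt; apply/negP => lt_sum.
have := le_trans prod_low eq; apply/negP; rewrite -ltNge.
rewrite exprVn -!powR_mulrn// -powRN -powRrM.
rewrite (_ : t%:R * - w = - (t%:R * w)); last by ring.
by apply: lt_powR2; rewrite ltrN2 mulrC.
Qed.

End error_functions.

Section exceptional_set.
Context {R : realType} {n : nat}.
Hypothesis n_gt0 : (0 < n)%N.
Implicit Types (x : 'rV[R]_n) (th : 'cV[R]_n).

Lemma nint_continuous : continuous (@nint R).
Proof.
move=> y; apply/cvgrPdist_lt => e e0; near=> z.
have h : `|y - z| < e by near: z; exact: cvgr_dist_lt.
apply: le_lt_trans h; rewrite ler_norml; apply/andP; split.
  have := nintD (z - y) y; rewrite subrK => h1.
  by have := nint_le_norm (z - y); rewrite distrC; lra.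
have := nintD (y - z) z; rewrite subrK => h1.
by have := nint_le_norm (y - z); lra.
Unshelve. all: by end_near. Qed.

Lemma nint_form_continuous th (q : int) j :
  continuous (fun x : 'rV[R]_n => nint (q%:~R * x 0 j + th j 0)).
Proof.
move=> x.
have h : {for x, continuous (fun z : 'rV[R]_n => q%:~R * z 0 j + th j 0)}.
  apply: (@continuousD _ _ _ (fun z : 'rV[R]_n => q%:~R * z 0 j) (fun=> th j 0)).
    apply: (@continuousM _ _ (fun=> q%:~R) (fun z : 'rV[R]_n => z 0 j)).
      exact: cst_continuous.
    exact: coord_continuous.
  exact: cst_continuous.
exact: (continuous_comp h (@nint_continuous _)).
Qed.

Definition bad_after mult th m T : set 'rV[R]_n :=
  [set x | exists2 t, (T <= t)%N & exists2 tau, tau \in profiles mult m t & bad th tau x].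

Definition zero_set mult th : set 'rV[R]_n := [set x | exists2 q : int, q != 0 &
  if mult then exists j, nint (q%:~R * x 0 j + th j 0) = 0
  else forall j, nint (q%:~R * x 0 j + th j 0) = 0].

(* A Borel subset of the whole of R^n, so that a negligible subset of M can be
   exhibited without choosing a countable atlas. The set zero_set takes care of
   the points approximated for arbitrarily large Q by one and the same q. *)
Definition exceptional mult th : set (borel_rV R n) :=
  (\bigcup_m \bigcap_T bad_after mult th m T) `|` zero_set mult th.

Lemma open_bad_after mult th m T : open (bad_after mult th m T).
Proof.
rewrite openE => x [t tT [tau tautA [q [q1 q2]]]].
suff : \forall z \near x, forall j, nint (q%:~R * (z : 'rV[R]_n) 0 j + th j 0) < 2^-1 ^+ tau j.
  by apply: filterS => z hz; exists t => //; exists tau => //; exists q.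
apply: (@filter_forall _ _ (fun j (z : 'rV[R]_n) =>
  nint (q%:~R * z 0 j + th j 0) < 2^-1 ^+ tau j) (nbhs x) (nbhs_filter x)) => j.
by have /cvgr_lt := @nint_form_continuous th q j x; apply.
Qed.

Lemma measurable_borel (V : set (borel_rV R n)) : open (V : set 'rV[R]_n) -> measurable V.
Proof. by move=> oV; exact: sub_sigma_algebra. Qed.

Lemma measurable_exceptional mult th : measurable (exceptional mult th).
Proof.
apply: measurableU.
  apply: bigcupT_measurable => m; apply: bigcapT_measurable => T.
  by apply: measurable_borel; exact: open_bad_after.
pose F q j := fun x : 'rV[R]_n => nint (q%:~R * x 0 j + th j 0).
pose Z q j : set (borel_rV R n) := F q j @^-1` [set 0].
have mZ q j : measurable (Z q j).
  rewrite -[Z q j]setCK; apply: measurableC; apply: measurable_borel.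
  have -> : ~` Z q j = F q j @^-1` [set r | 0 < r].
    apply/seteqP; split=> x /=; rewrite /Z /F /=.
      by move/eqP => h; rewrite lt_neqAle eq_sym h nint_ge0.
    by move=> + h; rewrite h ltxx.
  apply: open_comp; last exact: open_gt.
  by move=> x _; exact: nint_form_continuous.
rewrite (_ : zero_set mult th = \bigcup_(q : int) (if q == 0 then set0 else
    if mult then \bigcup_(j : 'I_n) Z q j else \bigcap_(j : 'I_n) Z q j)).
  apply: countable_bigcupT_measurable => // q; case: eqP => // _.
  case: mult; first exact: countable_bigcupT_measurable.
  by apply: fin_bigcap_measurable => //; exact: finite_finset.
apply/seteqP; split=> x.
  move=> [q q0 h]; exists q => //; rewrite (negbTE q0); case: mult h => [[j hj]|hj].
    by exists j.
  by move=> j _; exact: hj.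
move=> [q _]; case: eqP => // /eqP q0 h; exists q => //.
by case: mult h => [[j _ hj]|h]; [exists j|move=> j; exact: h].
Qed.

Lemma exceptional_of_exponent mult x th :
  (1 < int_exponent (err mult x th))%E -> exceptional mult th x.
Proof.
move=> /int_exponent_gt1[m hm]; set f := err mult x th in hm.
have [|nZ] := pselect (zero_set mult th x); first by right.
have fpos q : q != 0 -> 0 < f q.
  move=> q0; rewrite lt_neqAle err_ge0 andbT eq_sym; apply/eqP => /err_eq0 h.
  by apply: nZ; exists q.
left; exists m => // T _.
(* At least [1 / f q] for every nonzero [q] with [|q| < 2 ^ T]; for [Q > Q0] such a [q] has
   [f q > 1 / Q] and is no solution. *)
pose Q0 := \sum_(i < 2 ^ T) ((f (i : nat)%:Z)^-1 + (f (- (i : nat)%:Z))^-1).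
have [Q [Q1 Q2 [q [q0 fq qQ]]]] := hm Q0.
have Qp : 0 < Q by lra.
have finv z : 0 <= (f z)^-1 by rewrite invr_ge0 err_ge0.
have qT : (2 ^ T <= absz q)%N.
  rewrite leqNgt; apply/negP => qT.
  have h1 : (f q)^-1 <= Q0.
    rewrite /Q0 (bigD1 (Ordinal qT))//=.
    have rest : 0 <= \sum_(i < 2 ^ T | i != Ordinal qT) ((f (i : nat)%:Z)^-1 + (f (- (i : nat)%:Z))^-1).
      by apply: sumr_ge0 => i _; rewrite addr_ge0.
    have [E|E] : q = (absz q)%:Z \/ q = - (absz q)%:Z by lia.
      by rewrite -E; have := finv (- q); lra.
    by rewrite -E; have := finv (absz q)%:Z; lra.
  have h2 : Q^-1 < f q.
    by rewrite -[ltRHS]invrK ltf_pV2 ?posrE ?invr_gt0// ?fpos// (le_lt_trans h1).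
  have h3 : Q `^ (- (1 + m.+1%:R^-1)) <= Q^-1.
    rewrite -(powR_inv1 (ltW Qp)) ler_powR ?(ltW Q2)// lerN2 lerDl.
    by rewrite invr_ge0.
  by have := lt_trans h2 (lt_le_trans fq h3); rewrite ltxx.
have qpos : (0 < absz q)%N by rewrite absz_gt0.
pose t := trunc_log 2 (absz q).
have qt : (2 ^ t <= absz q < 2 ^ t.+1)%N by exact: trunc_log_bounds.
exists t; first exact: trunc_log_max.
apply: (profile_exists n_gt0 qt); apply: (le_trans (ltW fq)).
have tQ : 2 ^+ t <= Q.
  apply: le_trans qQ; rewrite norm_intr -natrX ler_nat.
  by case/andP: qt.
have t0 : 0 < (2 : R) ^+ t by rewrite exprn_gt0.
rewrite !powRN lef_pV2 ?posrE ?powR_gt0//.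
have p0 : 0 <= 1 + m.+1%:R^-1 :> R by rewrite addr_ge0// invr_ge0.
by apply: ge0_ler_powR => //; rewrite nnegrE ltW.
Qed.

Lemma eventually_not_bad_hom mult x m (K : R) : 0 <= K ->
  (int_exponent (err mult x 0) <= 1)%E ->
  exists T : nat, forall t, (T <= t)%N -> forall tau, tau \in profiles mult m t ->
    ~ bad_hom K tau x.
Proof.
(* Half of the excess of the profiles over 1; the other half yields the factor [2 ^ (b * t)] that
   absorbs [enlargement]. *)
move=> K0 hle; pose b : R := m.+1%:R^-1 / 2.
have b0 : 0 < b by rewrite divr_gt0// invr_gt0.
have [|Q0 hQ] := int_exponent_le1 hle (w := 1 + b); first by lra.
pose w := 1 + b.
have [T hT] := poly_lt_powR ((K * 2 ^+ n.+2) ^+ n * 2 ^+ n * 2 `^ (2 * w)) (n.+2 * n) b0.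
exists (maxn T (Num.truncn `|Q0|).+1) => t; rewrite geq_max => /andP[/hT {}hT tQ].
move=> tau; rewrite inE => /andP[tc tsum] [r [r0 r1 r2]].
have Q0t : Q0 < 2 ^+ t.+2.
  apply: (le_lt_trans (ler_norm _)); apply: (lt_trans (truncnS_gt _)).
  rewrite -natrX ltr_nat (leq_ltn_trans tQ)// (ltn_trans (ltn_expl t (isT : 1 < 2)%N))//.
  by rewrite ltn_exp2l.
apply: (hQ (2 ^+ t.+2)) => //; first by rewrite exprn_egt1// ltr1n.
exists r; split=> //; last by rewrite norm_intr -natrX ler_nat.
set M : R := (enlargement t)%:R in r2.
have M0 : 0 <= M by [].
have h1 : err mult x 0 r <= \prod_j (K * M * 2^-1 ^+ tau j).
  apply: (err_le n_gt0) => [j|]; first by rewrite mxE addr0; apply/ltW/r2.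
  case: mult tc {hle hQ tsum} => //= /forallP tc; apply/forallP => j.
  by apply/forallP => k; rewrite (eqP (forallP (tc j) k)).
apply: (le_lt_trans h1).
rewrite big_split /= prodr_const card_ord prodrXr exprVn.
have KM : (K * M) ^+ n <= (K * 2 ^+ n.+2) ^+ n * t.+1%:R ^+ (n.+2 * n).
  rewrite exprM -exprMn; apply: lerXn2r; rewrite ?nnegrE.
  - exact: mulr_ge0.
  - by apply: mulr_ge0; [apply: mulr_ge0 => //; exact: exprn_ge0|exact: exprn_ge0].
  - by rewrite -[leRHS]mulrA ler_wpM2l//; exact: enlargement_le.
have E2 : (2 ^+ (\sum_j tau j))^-1 <= (2 : R) ^+ n * 2 `^ (- ((1 + 2 * b) * t%:R)).
  rewrite -!powR_mulrn// -powRN -powRD; last by rewrite pnatr_eq0 implybT.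
  rewrite ler_powR ?ler1n//.
  have m0 : (0 : R) < m.+1%:R by [].
  move: tsum; rewrite -(ler_nat R) !natrM natrD -ler_pdivrMl// => tsum.
  have : (1 + 2 * b) * t%:R = m.+1%:R^-1 * (m.+2%:R * t%:R).
    by rewrite /b -[m.+2%:R]natr1; field; rewrite gt_eqF.
  by move=> E; move: tsum; rewrite -E; lra.
apply: (@le_lt_trans _ _ ((K * 2 ^+ n.+2) ^+ n * t.+1%:R ^+ (n.+2 * n) *
    (2 ^+ n * 2 `^ (- ((1 + 2 * b) * t%:R))))).
  by apply: ler_pM => //; apply: exprn_ge0; exact: mulr_ge0.
rewrite -[2 ^+ t.+2]powR_mulrn// -powRrM.
have P (z : R) : 0 < 2 `^ z by rewrite powR_gt0.
rewrite -(ltr_pM2l (P (2 * w + (1 + 2 * b) * t%:R))) -powRD; last by rewrite pnatr_eq0 implybT.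
rewrite (_ : 2 * w + (1 + 2 * b) * t%:R + t.+2%:R * - (1 + b) = b * t%:R); last first.
  by rewrite /w -[t.+2]addn2 natrD; ring.
apply: le_lt_trans hT; rewrite powRD; last by rewrite pnatr_eq0 implybT.
rewrite powRN le_eqVlt; apply/orP; left; apply/eqP; field.
by rewrite gt_eqF.
Qed.

End exceptional_set.

(** * Transference on the submanifold *)

Section chart_transference.
Context {R : realType} {d n : nat}.
Hypothesis n_gt0 : (0 < n)%N.

Lemma tame_sub (phi : 'rV[R]_d -> 'rV[R]_n) good (D D' : set 'rV[R]_d) c C :
  D' `<=` D -> tame phi good D c C -> tame phi good D' c C.
Proof.
move=> DD [h1 h2]; split=> [u v j e /DD Du /DD Dv|j /h2[i hi]]; first exact: h1.
by exists i => u v e /DD Du /DD Dv; exact: hi.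
Qed.

(** The two cases part here: in a constant profile any good [j0] attains the maximum, whereas in
    general every coordinate must be good. The inequality follows from [t <= \sum_k tau k + n]. *)
Lemma profiles_argmax (mult : bool) (good : set 'I_n) (j0 : 'I_n) m t tau :
  good j0 -> (mult -> forall j, good j) -> tau \in profiles mult m t ->
  exists2 j, good j & (forall k, (tau k <= tau j)%N) /\ (t <= n * tau j + n)%N.
Proof.
move=> g0 gall; rewrite inE => /andP[tc tsum].
have [j gj jmax] : exists2 j, good j & forall k, (tau k <= tau j)%N.
  move: tc; case: mult gall => [gall _|_ /forallP tc].
    have [j _ hj] := @arg_maxnP _ j0 xpredT (fun j => tau j : nat) isT.
    by exists j => [|k]; [exact: gall|exact: hj].
  by exists j0 => // k; rewrite (eqP (forallP (tc j0) k)).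
exists j => //; split=> //.
have : (\sum_k tau k <= n * tau j)%N.
  have -> : (n * tau j = \sum_(k < n) tau j)%N by rewrite sum_nat_const card_ord.
  exact: leq_sum.
by move: tsum; move: (\sum_k tau k)%N (n * tau j)%N => a b h1 h2; nia.
Qed.

Lemma exceptional_chart_null (M : set 'rV[R]_n) U (phi : 'rV[R]_d -> 'rV[R]_n)
    mult (th : 'cV[R]_n) (S : set 'rV[R]_d) :
  (0 < d)%N -> local_parametrization M U phi -> S `<=` U ->
  (forall u, S u -> exceptional mult th (phi u)) ->
  (forall u, S u -> (int_exponent (err mult (phi u) 0) <= 1)%E) ->
  (forall u, S u -> mult -> forall j, exists i, 'J phi u i j != 0) ->
  null S.
Proof.
move=> d0 [oU [phiC phiI] _ _] SU Sexc Shom Sgood.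
apply: null_locally => u Su.
have Uu := SU u Su.
have [r [c [C [r0 c0 C0 tm]]]] := C1_tame oU phiC Uu.
exists r => // a l l0 al.
have {}tm := tame_sub al tm.
set good := [set j | _] in tm.
have gall : mult -> forall j, good j by move=> mt j; exact: Sgood.
(* Otherwise the differential vanishes, against its injectivity as [d > 0]. *)
have [j0 g0] : exists j, good j.
  apply: contrapT => /forallNP ng.
  pose e : 'rV[R]_d := const_mx 1.
  have [du _] := phiC u Uu.
  have e0 : e = 0.
    apply: (phiI u Uu); rewrite linear0 diff_jacobian//.
    apply/matrixP => i j; rewrite [LHS]mxE [RHS]mxE big1// => k _.
    suff -> : 'J phi u k j = 0 by rewrite mulr0.
    by apply: contrapT => /eqP h; apply: (ng j); exists k.
  have := congr1 (fun N : 'rV[R]_d => N 0 (Ordinal d0)) e0.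
  by rewrite !mxE => /eqP; rewrite oner_eq0.
have bad_null m := bad_limsup_null l0 c0 C0 tm th
  (fun t tau => @profiles_argmax mult good j0 m t tau g0 gall).
have [K hK] := choice (fun m => (let: ex_intro2 K K0 Kn := bad_null m in
  ex_intro _ K (conj K0 Kn))).
(* Once [q], [j] and the nearest integer are fixed, a zero error describes a level set of
   [phi_j]. *)
pose Z (p : int * 'I_n * int) := [set v | cube a l v /\ `[< good p.1.2 >] /\
  phi v 0 p.1.2 = (p.2%:~R - th p.1.2 0) / p.1.1%:~R].
pose B m := [set v | [/\ cube a l v,
  forall T : nat, exists2 t, (T <= t)%N & exists2 tau, tau \in profiles mult m t &
    bad th tau (phi v) &
  exists T : nat, forall t, (T <= t)%N -> forall tau, tau \in profiles mult m t ->
    ~ bad_hom (K m) tau (phi v)]].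
apply: (@null_sub _ _ _ ((\bigcup_m B m) `|` (\bigcup_p Z p))).
  move=> v [Sv Dv]; have [[m _ hm]|[q q0 hz]] := Sexc v Sv; [left|right].
    exists m => //; split=> //; first by move=> T; exact: hm.
    by apply: eventually_not_bad_hom => //; [exact: (hK m).1|exact: Shom].
  have [j gj hj] : exists2 j, good j & nint (q%:~R * phi v 0 j + th j 0) = 0.
    case: mult gall hz {bad_null hK B Sexc Shom Sgood} => [gall [j hj]|_ hj].
      by exists j => //; exact: gall.
    by exists j0.
  have [p hp] := nintE (q%:~R * phi v 0 j + th j 0).
  exists (q, j, p) => //; split=> //=; split; first exact/asboolP.
  have qR : q%:~R != 0 :> R by rewrite intr_eq0.
  move: hp; rewrite hj => /esym/eqP; rewrite normr_eq0 subr_eq0 => /eqP <-.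
  by rewrite addrK mulrC mulKf.
apply: negligibleU.
  by apply: null_bigcup => m; exact: (hK m).2.
apply: null_bigcup_count => -[[q j] p].
have [gj|ngj] := pselect (good j); last first.
  exists set0; rewrite measure0; split=> // t /= [_ [/asboolP]].
  by [].
have zn := level_set_null l0 c0 tm ((p%:~R - th j 0) / q%:~R) gj.
apply: (null_sub _ zn).
by move=> v [Dv [_ h]].
Qed.

End chart_transference.

Section almost_everywhere.
Context {R : realType} {d n : nat}.
Hypothesis d_gt0 : (0 < d)%N.
Variable M : set 'rV[R]_n.
Hypothesis M_submanifold : submanifold d M.

Lemma param_mem (U : set 'rV[R]_d) (phi : 'rV[R]_d -> 'rV[R]_n) u : local_parametrization M U phi -> U u -> M (phi u).
Proof.
move=> [oU _ _ phiM] Uu; have [V _ VE] := phiM U oU (@subset_refl _ U).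
by have [] : (M `&` V) (phi u) by rewrite -VE; exists u.
Qed.

Lemma submanifold_dim_gt0 x : M x -> (0 < n)%N.
Proof.
move=> /M_submanifold[U [phi [[_ [_ phiI] _ _] [u Uu _]]]].
rewrite lt0n; apply/eqP => n0.
have e0 : const_mx 1 = 0 :> 'rV[R]_d.
  apply: (phiI u Uu); apply/matrixP => i j.
  by have := ltn_ord j; rewrite {2}n0.
have := congr1 (fun N : 'rV[R]_d => N 0 (Ordinal d_gt0)) e0.
by rewrite !mxE => /eqP; rewrite oner_eq0.
Qed.

(** [tangent_space] collects vectors from all parametrizations through the point, so a zero column
    for [phi] has to be carried over to each of them. *)
Lemma jacobian_col_neq0 (U : set 'rV[R]_d) (phi : 'rV[R]_d -> 'rV[R]_n) u (j : 'I_n) : local_parametrization M U phi -> U u ->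
  ~ orthogonal_to_axis (tangent_space d M (phi u)) j -> exists i, 'J phi u i j != 0.
Proof.
move=> Uphi Uu nort; apply: contrapT => /forallNP J0; apply: nort.
have {}J0 i : 'J phi u i j = 0 by apply: contrapT => /eqP; exact: J0.
move=> _ [V [psi [u' [Vpsi Vu' xE [h ->]]]]].
have JJ := tangent_coord_eq0 Uphi Vpsi Uu Vu' xE J0.
have [_ [psiC _] _ _] := Vpsi.
rewrite diff_jacobian; last by have [] := psiC u' Vu'.
apply/matrixP => a b; rewrite [LHS]mxE [RHS]mxE big1// => k _.
rewrite [X in _ * X]mxE [X in _ * X]mxE !ord1 eqxx /=.
have [->|_] := eqVneq k j; last by rewrite mulr0.
by rewrite [X in X * _]mxE big1 ?mul0r// => i _; rewrite JJ mulr0.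
Qed.

Lemma ae_inhomogeneous (mult : bool) :
  (mult -> ae_on d M (fun x => forall i : 'I_n,
       ~ orthogonal_to_axis (tangent_space d M x) i)) ->
  ae_on d M (fun x => int_exponent (err mult x 0) = 1%E) ->
  forall th, ae_on d M (fun x => int_exponent (err mult x th) = 1%E).
Proof.
move=> tang [N1 [m1 z1 s1]] th.
have [N2 [m2 z2 s2]] : exists N2 : set (borel_rV R n), [/\ measurable N2,
    riemannian_measure d M N2 = 0%E & mult -> forall x, M x -> ~ N2 x -> forall i : 'I_n,
       ~ orthogonal_to_axis (tangent_space d M x) i].
  case: mult tang {s1} => [/(_ isT)[N2 [m2 z2 s2]]|_]; last by exists N1.
  exists N2; split=> // _ x Mx nx; apply: contrapT => h; apply: nx.
  exact: s2.
have hom x : M x -> ~ N1 x -> int_exponent (err mult x 0) = 1%E.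
  by move=> Mx nx; apply: contrapT => h; apply: nx; exact: s1.
exists (N1 `|` exceptional mult th); split.
- by apply: measurableU => //; exact: measurable_exceptional.
- apply: (riemannian_measure_cover m1 m2) => //.
    by apply: measurableU => //; exact: measurable_exceptional.
  move=> U phi Uphi.
  have [n0|n0] := posnP n; last first.
    apply: (exceptional_chart_null n0 d_gt0 Uphi (mult := mult) (th := th)).
    - by move=> u [].
    - by move=> u [_ [[[|//]]]].
    - move=> u [Uu [[_ nx] _]]; rewrite hom//; exact: param_mem Uphi Uu.
    - move=> u [Uu [[_ nx] ny]] mt j; apply: (jacobian_col_neq0 Uphi Uu).
      by apply: s2 => //; exact: param_mem Uphi Uu.
  apply: (@null_sub _ _ _ set0); last by exists set0; rewrite measure0; split=> // t.
  move=> u [Uu _]; have := submanifold_dim_gt0 (param_mem Uphi Uu).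
  by rewrite n0.
- move=> x [Mx nx]; have [N1x|nN1] := pselect (N1 x); [by left|right].
  have n0 := submanifold_dim_gt0 Mx.
  apply: exceptional_of_exponent => //.
  (* The lower bound excludes exponents below 1, so failing to equal 1 means exceeding it. *)
  rewrite lt_neqAle; apply/andP; split; first by apply/eqP => h; apply: nx.
  have le_err (y : 'cV[R]_n) : (int_exponent (sup_err x y) <= int_exponent (err mult x y))%E.
    by rewrite /err; case: (mult) => //; apply: int_exponent_le => q; exact: prod_err_le.
  apply: le_trans (le_err th); apply: int_exponent_ge1 => w w0 w1.
  apply: inhom_lower_bound => //.
  by apply: le_trans (le_err 0) _; rewrite hom.
Qed.

End almost_everywhere.

Theorem theorem4 (R : realType) (n d : nat) (d_gt0 : (0 < d)%N)
    (M : set 'rV[R]_n) (M_submanifold : submanifold d M) :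
  (extremal d M <-> sim_inhom_extremal d M) /\
  (ae_on d M (fun x => forall i : 'I_n,
       ~ orthogonal_to_axis (tangent_space d M x) i) ->
   (strongly_extremal d M <-> sim_inhom_strongly_extremal d M)).
Proof.
have supE (th : 'cV[R]_n) : (fun x : 'rV[R]_n => exponent x^T th = 1%E) =
    (fun x => int_exponent (err false x th) = 1%E).
  by apply/funext => x; rewrite exponentE.
have prodE (th : 'cV[R]_n) : (fun x : 'rV[R]_n => mult_exponent x^T th = 1%E) =
    (fun x => int_exponent (err true x th) = 1%E).
  by apply/funext => x; rewrite mult_exponentE.
split=> [|tang].
  (* The converse is the case [theta = 0]. *)
  split; last exact.
  rewrite /extremal /sim_inhom_extremal supE => h th; rewrite supE.
  exact: (ae_inhomogeneous d_gt0 M_submanifold (mult := false)).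
split; last exact.
rewrite /strongly_extremal /sim_inhom_strongly_extremal prodE => h th; rewrite prodE.
exact: (ae_inhomogeneous d_gt0 M_submanifold (mult := true)).
Qed.
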